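(* Let $E$ be a separable (real or complex) Banach space. Then there is a C-rich subspace $X(E)$ of $C[0,1]$ (continuous functions with values in the same scalar field as $E$) such that $X(E)^*$ contains an isometrically isomorphic copy of $E^*$ as an $L$-summand.
   Context: C-rich: for a compact Hausdorff space $K$, a closed subspace $X$ of $C(K)$ (with the supremum norm) is C-rich if for every nonempty open subset $U$ of $K$ and every $\varepsilon>0$, there is a positive (i.e. nonnegative real-valued) continuous function $h$ on $K$ of norm $1$ with support inside $U$ such that the distance from $h$ to $X$ is less than $\varepsilon$. $L$-summand: a closed subspace $Z$ of a Banach space $X$ is an $L$-summand of $X$ if $X=Z\oplus_1 W$ for some closed subspace $W$ of $X$, i.e. $X$ is the direct sum of $Z$ and $W$ and $\|z+w\|=\|z\|+\|w\|$ for all $z\in Z$, $w\in W$. *)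

(* Defs.v *)
From HB Require Import structures.
From mathcomp Require Import all_boot all_order all_algebra.
From mathcomp Require Import complex.
From mathcomp Require Import all_classical all_reals all_analysis.

Set Implicit Arguments.
Unset Strict Implicit.
Unset Printing Implicit Defensive.

Import Order.TTheory GRing.Theory Num.Theory.
Import numFieldNormedType.Exports.

Local Open Scope classical_set_scope.
Local Open Scope ring_scope.

Variant scalar_kind := RealScalars | ComplexScalars.

Definition scalars (R : realType) (k : scalar_kind) : numFieldType :=
  match k with
  | RealScalars => R : numFieldType
  | ComplexScalars => R[i] : numFieldType
  end.

Arguments scalars : simpl never.

Section Scalars.
Context (R : realType) (k : scalar_kind).
Local Notation K := (scalars R k).

Definition of_real : R -> K :=
  match k return R -> scalars R k with
  | RealScalars => fun x => x
  | ComplexScalars => fun x => real_complex R x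
  end.

Definition real_part : K -> R :=
  match k return scalars R k -> R with
  | RealScalars => fun x => x
  | ComplexScalars => fun x => complex.Re x
  end.

(* Norms of a [normedModType K] take values in [K]; suprema and infima live in
   [R], so [rnorm] is the same norm read in [R]. *)
Definition rnorm (V : normedModType K) (v : V) : R := real_part `|v|.

Lemma of_realK : cancel of_real real_part.
Proof. by rewrite /of_real /real_part; case: k. Qed.

Lemma real_partK (x : K) : x \is Num.real -> of_real (real_part x) = x.
Proof.
by move: x; rewrite /of_real /real_part; case: k => //= x /RRe_real.
Qed.

Lemma of_realD (x y : R) : of_real (x + y) = of_real x + of_real y.
Proof. by rewrite /of_real; case: k => //=; exact: rmorphD. Qed.

Lemma of_realM (x y : R) : of_real (x * y) = of_real x * of_real y.
Proof. by rewrite /of_real; case: k => //=; exact: rmorphM. Qed.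

Lemma of_real0 : of_real 0 = 0.
Proof. by rewrite /of_real; case: k. Qed.

Lemma ler_of_real (x y : R) : (of_real x <= of_real y) = (x <= y).
Proof. by rewrite /of_real; case: k => //=; exact: lecR. Qed.

Lemma ltr_of_real (x y : R) : (of_real x < of_real y) = (x < y).
Proof. by rewrite !lt_neqAle ler_of_real (can_eq of_realK). Qed.

Lemma of_real_rnorm (V : normedModType K) (v : V) : of_real (rnorm v) = `|v|.
Proof. by rewrite /rnorm real_partK ?normr_real. Qed.

Lemma rnorm_ge0 (V : normedModType K) (v : V) : 0 <= rnorm v.
Proof. by rewrite -ler_of_real of_real0 of_real_rnorm normr_ge0. Qed.

Lemma ler_rnormD (V : normedModType K) (u v : V) :
  rnorm (u + v) <= rnorm u + rnorm v.
Proof. by rewrite -ler_of_real of_realD !of_real_rnorm ler_normD. Qed.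

Lemma ler_dist_rnorm (V : normedModType K) (u v : V) :
  `|rnorm u - rnorm v| <= rnorm (u - v).
Proof.
have vu : rnorm v <= rnorm (u - v) + rnorm u.
  have -> : rnorm (u - v) = rnorm (v - u) by rewrite /rnorm distrC.
  by rewrite -{1}(subrK u v) ler_rnormD.
rewrite ler_norml lerNl opprB !lerBlDr vu/=.
by rewrite -{1}(subrK v u) ler_rnormD.
Qed.

Lemma rnormZ (V : normedModType K) (a : K) (v : V) :
  rnorm (a *: v) = rnorm (a : K^o) * rnorm v.
Proof.
by apply: (can_inj of_realK); rewrite of_realM !of_real_rnorm normrZ.
Qed.

Lemma rnorm_eq0 (V : normedModType K) (v : V) : rnorm v = 0 -> v = 0.
Proof.
move=> v0; apply/eqP; rewrite -normr_eq0 -of_real_rnorm v0; exact/eqP/of_real0.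
Qed.

End Scalars.

Arguments of_real {R k}.
Arguments real_part {R k}.
Arguments rnorm {R k V}.

Section SupNorm.
Context (R : realType) (k : scalar_kind) (I : Type) (A : set I).
Local Notation K := (scalars R k).

Definition rsup (f : I -> K^o) : R := sup [set rnorm (f i) | i in A].

Definition rbounded (f : I -> K^o) :=
  exists M : R, forall i, A i -> rnorm (f i) <= M.

Lemma rsup_ub f i : rbounded f -> A i -> rnorm (f i) <= rsup f.
Proof.
move=> [M fM] Ai; apply: ub_le_sup; last by exists i.
by exists M => _ [j Aj <-]; exact: fM.
Qed.

Lemma rsup_le f M : 0 <= M -> (forall i, A i -> rnorm (f i) <= M) ->
  rsup f <= M.
Proof.
move=> M0 fM; rewrite /rsup.
have [->|/set0P A0] := eqVneq A set0; first by rewrite image_set0 sup0.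
apply: ge_sup; first by case: A0 => i Ai; exists (rnorm (f i)), i.
by move=> _ [i Ai <-]; exact: fM.
Qed.

Lemma rsup_ge0 f : rbounded f -> 0 <= rsup f.
Proof.
move=> fb; have [A0|/set0P[i Ai]] := eqVneq A set0.
  by rewrite /rsup A0 image_set0 sup0.
by rewrite (le_trans (rnorm_ge0 (f i)))// rsup_ub.
Qed.

Lemma rsupD f g : rbounded f -> rbounded g ->
  rsup (fun i => f i + g i) <= rsup f + rsup g.
Proof.
move=> fb gb; apply: rsup_le => [|i Ai]; first by rewrite addr_ge0 ?rsup_ge0.
by rewrite (le_trans (ler_rnormD _ _))// lerD ?rsup_ub.
Qed.

Lemma rsupZ_le (a : K) f : rbounded f ->
  rsup (fun i => a *: f i) <= rnorm (a : K^o) * rsup f.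
Proof.
move=> fb; apply: rsup_le => [|i Ai].
  by rewrite mulr_ge0 ?rsup_ge0// rnorm_ge0.
by rewrite rnormZ ler_wpM2l ?rnorm_ge0// rsup_ub.
Qed.

Lemma rboundedZ (a : K) f : rbounded f -> rbounded (fun i => a *: f i).
Proof.
move=> [M fM]; exists (rnorm (a : K^o) * M) => i Ai.
by rewrite rnormZ ler_wpM2l ?rnorm_ge0// fM.
Qed.

Lemma rnorm0 : rnorm (0 : K^o) = 0 :> R.
Proof.
by apply: (can_inj (@of_realK R k)); rewrite of_real_rnorm normr0 of_real0.
Qed.

Lemma rsupZ (a : K) f : rbounded f ->
  rsup (fun i => a *: f i) = rnorm (a : K^o) * rsup f.
Proof.
move=> fb; apply/eqP; rewrite eq_le rsupZ_le//=.
have [->|a0] := eqVneq a 0.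
  rewrite rnorm0 mul0r rsup_ge0//; exact: rboundedZ.
have := rsupZ_le a^-1 (rboundedZ a fb).
under [X in rsup X]eq_fun do rewrite scalerA mulVf// scale1r.
move=> /(ler_wpM2l (rnorm_ge0 (a : K^o))); rewrite mulrA.
suff -> : rnorm (a : K^o) * rnorm (a^-1 : K^o) = 1 by rewrite mul1r.
apply: (can_inj (@of_realK R k)).
rewrite of_realM !of_real_rnorm -normrM mulfV// normr1.
by rewrite /of_real; case: k.
Qed.

Lemma rsup_eq0 f : rbounded f -> rsup f = 0 -> forall i, A i -> f i = 0.
Proof.
move=> fb f0 i Ai; apply: (@rnorm_eq0 R k); apply/eqP.
by rewrite eq_le rnorm_ge0 andbT -f0 rsup_ub.
Qed.

End SupNorm.

Section Dual.
Context (R : realType) (k : scalar_kind) (V : normedModType (scalars R k)).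
Local Notation K := (scalars R k).

Definition is_dual : {pred V -> K^o} :=
  mem [set f : V -> K^o | linear f /\ continuous f].

Lemma is_dual_submod_closed : submod_closed is_dual.
Proof.
split=> [|a f g]; rewrite !inE /=.
  by split=> [b u v|]; [rewrite /= scaler0 addr0|exact: cst_continuous].
move=> [fl fc] [gl gc]; split=> [b u v|x].
  rewrite /= !fctE /= fl gl !scalerDr !scalerA mulrC -!addrA; congr (_ + _).
  by rewrite addrCA.
by apply: cvgD; [apply: cvgZr; exact: fc|exact: gc].
Qed.

HB.instance Definition _ :=
  GRing.isSubmodClosed.Build K (V -> K^o) is_dual is_dual_submod_closed.

Definition dual_space := {f : V -> K^o | f \in is_dual}.

HB.instance Definition _ := SubChoice.on dual_space.
HB.instance Definition _ := [SubChoice_isSubLmodule of dual_space by <:].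

Definition closed_unit_ball : set V := [set v | `|v| <= 1].

Definition dual_norm (f : dual_space) : K :=
  of_real (rsup closed_unit_ball (val f)).

Lemma dual_rbounded (f : dual_space) : rbounded closed_unit_ball (val f).
Proof.
have /set_mem[fl fc] := valP f.
pose F : {linear V -> K^o} := HB.pack (val f)
  (@GRing.isLinear.Build K V K^o *:%R (val f) fl).
have /linear_boundedP/pinfty_ex_gt0[M M0 FM] : bounded_near F (nbhs 0).
  by apply/continuous_linear_bounded; exact: fc.
exists (real_part M) => v v1; rewrite -(ler_of_real k) real_partK ?gtr0_real//.
by rewrite of_real_rnorm (le_trans (FM v))// ler_piMr// ltW.
Qed.

Lemma ler_dual_normD (f g : dual_space) :
  dual_norm (f + g) <= dual_norm f + dual_norm g.
Proof.
by rewrite -of_realD ler_of_real rsupD//; exact: dual_rbounded.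
Qed.

Lemma dual_normZ (a : K) (f : dual_space) :
  dual_norm (a *: f) = `|a| * dual_norm f.
Proof.
rewrite -[`|a|](@of_real_rnorm R k K^o) -of_realM; congr of_real.
by rewrite -rsupZ//; exact: dual_rbounded.
Qed.

Lemma dual_norm_eq0 (f : dual_space) : dual_norm f = 0 -> f = 0.
Proof.
rewrite -(of_real0 R k) => /(can_inj (@of_realK R k)) f0.
have /set_mem[fl _] := valP f.
pose F : {linear V -> K^o} := HB.pack (val f)
  (@GRing.isLinear.Build K V K^o *:%R (val f) fl).
apply/val_inj/funext => v; change (F v = 0).
have [->|v0] := eqVneq v 0; first exact: linear0.
have nv0 : `|v| != 0 by rewrite normr_eq0.
have : F (`|v|^-1 *: v) = 0.
  apply: (rsup_eq0 (dual_rbounded f) f0).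
  by rewrite /closed_unit_ball /= normrZ normfV normr_id mulVf.
by rewrite linearZ/= => /eqP; rewrite scaler_eq0 invr_eq0 (negbTE nv0) => /eqP.
Qed.

HB.instance Definition _ := Lmodule_isNormed.Build K dual_space
  ler_dual_normD dual_normZ dual_norm_eq0.

End Dual.

Structure compactHausdorff := CompactHausdorff {
  ch_sort :> topologicalType;
  ch_compact : compact [set: ch_sort];
  ch_hausdorff : hausdorff_space ch_sort
}.

Section ContinuousFunctions.
Context (R : realType) (k : scalar_kind) (T : compactHausdorff).
Local Notation K := (scalars R k).

Definition is_continuous : {pred T -> K^o} :=
  mem [set f : T -> K^o | continuous f].

Lemma is_continuous_submod_closed : submod_closed is_continuous.
Proof.
split=> [|a f g]; rewrite !inE /=; first exact: cst_continuous.
by move=> fc gc x; apply: cvgD; [apply: cvgZr; exact: fc|exact: gc].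
Qed.

HB.instance Definition _ := GRing.isSubmodClosed.Build K (T -> K^o)
  is_continuous is_continuous_submod_closed.

Definition cont_space := {f : T -> K^o | f \in is_continuous}.

HB.instance Definition _ := SubChoice.on cont_space.
HB.instance Definition _ := [SubChoice_isSubLmodule of cont_space by <:].

Definition sup_norm (f : cont_space) : K := of_real (rsup [set: T] (val f)).

Lemma cont_rbounded (f : cont_space) : rbounded [set: T] (val f).
Proof.
have /set_mem fc := valP f.
have nfc : continuous (fun t => rnorm (val f t) : R).
  move=> t; apply/cvgrPdist_lt => e e0.
  have e0' : 0 < of_real e :> K by rewrite -(of_real0 R k) ltr_of_real.
  move/cvgrPdist_lt : (fc t) => /(_ _ e0'); apply: filterS => s.
  rewrite -of_real_rnorm ltr_of_real; apply: le_lt_trans.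
  exact: ler_dist_rnorm.
have /compact_bounded/pinfty_ex_gt0[M _ fM] :
    compact [set (rnorm (val f t) : R) | t in [set: T]].
  apply: continuous_compact; last exact: ch_compact.
  exact: continuous_subspaceT.
exists M => t _; apply: le_trans (fM _ _); first exact: ler_norm.
by exists t.
Qed.

Lemma ler_sup_normD (f g : cont_space) :
  sup_norm (f + g) <= sup_norm f + sup_norm g.
Proof.
by rewrite -of_realD ler_of_real rsupD//; exact: cont_rbounded.
Qed.

Lemma sup_normZ (a : K) (f : cont_space) :
  sup_norm (a *: f) = `|a| * sup_norm f.
Proof.
rewrite -[`|a|](@of_real_rnorm R k K^o) -of_realM; congr of_real.
by rewrite -rsupZ//; exact: cont_rbounded.
Qed.

Lemma sup_norm_eq0 (f : cont_space) : sup_norm f = 0 -> f = 0.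
Proof.
rewrite -(of_real0 R k) => /(can_inj (@of_realK R k)) f0.
by apply/val_inj/funext => t; exact: (rsup_eq0 (cont_rbounded f) f0).
Qed.

HB.instance Definition _ := Lmodule_isNormed.Build K cont_space
  ler_sup_normD sup_normZ sup_norm_eq0.

End ContinuousFunctions.

Arguments cont_space : clear implicits.

Structure closed_subspace (K : numFieldType) (V : normedModType K) :=
  ClosedSubspace {
    cs_submod :> submodClosed V;
    cs_closed : closed [set` cs_submod]
  }.

Section ClosedSubspace.
Context (K : numFieldType) (V : normedModType K) (X : closed_subspace V).

Definition subspace_of := {v : V | v \in X}.

HB.instance Definition _ := SubChoice.on subspace_of.
HB.instance Definition _ := [SubChoice_isSubLmodule of subspace_of by <:].

Definition subspace_norm (v : subspace_of) : K := `|val v|.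

Lemma ler_subspace_normD (u v : subspace_of) :
  subspace_norm (u + v) <= subspace_norm u + subspace_norm v.
Proof. exact: ler_normD. Qed.

Lemma subspace_normZ (a : K) (v : subspace_of) :
  subspace_norm (a *: v) = `|a| * subspace_norm v.
Proof. exact: normrZ. Qed.

Lemma subspace_norm_eq0 (v : subspace_of) : subspace_norm v = 0 -> v = 0.
Proof. by move=> /normr0_eq0 v0; exact: val_inj. Qed.

HB.instance Definition _ := Lmodule_isNormed.Build K subspace_of
  ler_subspace_normD subspace_normZ subspace_norm_eq0.

End ClosedSubspace.

Definition L_summand (K : numFieldType) (V : normedModType K)
    (Z : closed_subspace V) : Prop :=
  exists W : closed_subspace V,
    [/\ forall v : V, exists z w : V,
          [/\ z \in Z, w \in W & v = z + w],
        forall v : V, v \in Z -> v \in W -> v = 0 &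
        forall z w : V, z \in Z -> w \in W ->
          `|z + w| = `|z| + `|w| ].

Definition isometrically_isomorphic (K : numFieldType)
    (U V : normedModType K) : Prop :=
  exists f : {linear U -> V}, bijective f /\ forall u, `|f u| = `|u|.

Definition separable_space (T : topologicalType) : Prop :=
  exists2 D : set T, countable D & dense D.

Section CRich.
Context (R : realType) (k : scalar_kind) (T : compactHausdorff).

Definition distance (h : cont_space R k T)
    (X : closed_subspace (cont_space R k T)) : R :=
  inf [set rnorm (h - x) | x in [set` X]].

Definition closed_support (h : cont_space R k T) : set T :=
  closure [set t | val h t != 0].

(* In [R[i]], [0 <= z] means that [z] is a nonnegative real. *)
Definition C_rich (X : closed_subspace (cont_space R k T)) : Prop :=
  forall (U : set T) (e : R), open U -> U !=set0 -> 0 < e ->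
  exists h : cont_space R k T,
    [/\ forall t, 0 <= val h t,
        `|h| = 1,
        closed_support h `<=` U &
        distance h X < e].

End CRich.

Section UnitInterval.
Context (R : realType).

Definition unit_itv_type : topologicalType :=
  set_type (`[0, 1] : set R).

Lemma unit_itv_nbhs (x : unit_itv_type) (A : set unit_itv_type) :
  nbhs x A -> exists2 B : set R, nbhs (val x) B & val @^-1` B `<=` A.
Proof.
move=> [_ [[B oB <-] Bx BA]]; exists B => //; exact: open_nbhs_nbhs.
Qed.

Lemma unit_itv_compact : compact [set: unit_itv_type].
Proof.
move=> F FF _; pose v (x : unit_itv_type) : R := val x.
have vF01 : (v @ F) [set` `[0, 1]].
  change (F (v @^-1` [set` `[0, 1]])).
  apply: (@filterS _ F _ setT); last exact: filterT.
  by move=> x _; exact: set_mem (valP x).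
have [p [p01 Fp]] := @segment_compact R 0 1 _ (fmap_proper_filter v FF) vF01.
exists (exist _ p (mem_set p01)); split=> // A B FA /unit_itv_nbhs[C pC CB].
have vFA : (v @ F) (v @` A).
  change (F (v @^-1` (v @` A))).
  by apply: (@filterS _ F _ A) => // x Ax; exists x.
by have [_ [[x Ax <-] Cx]] := Fp _ _ vFA pC; exists x; split=> //; exact: CB.
Qed.

Lemma unit_itv_hausdorff : hausdorff_space unit_itv_type.
Proof.
move=> p q pq; apply: val_inj; apply: (@norm_hausdorff R R^o) => A B pA qB.
have vc : continuous (val : unit_itv_type -> R) by exact: initial_continuous.
have [x [Ax Bx]] := pq _ _ (vc p A pA) (vc q B qB).
by exists (val x).
Qed.

Definition unit_interval : compactHausdorff :=
  CompactHausdorff unit_itv_compact unit_itv_hausdorff.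

End UnitInterval.

(* Main.v *)
(* As in the proof of the Banach-Mazur theorem, the points of a closed nowhere
   dense set D of [0,1] code functionals phi_t in the unit ball of E^*, with
   every value phi_t(x) continuous in t and |x| = max_D |phi_t(x)|.  Here D
   lies in a Cantor set whose digits are read off by cosines of growing
   frequency (Schoenberg's space-filling curve), and t is kept when the digits
   give the values of such a functional on a dense sequence; no functional is
   missed, by Hahn-Banach.
   The space X(E) consists of the f in C[0,1] whose restriction to D has the
   form t |-> phi_t(x).  It contains every function vanishing on D, so it is
   C-rich.  The map f |-> x is a quotient map of X(E) onto E with kernel
   J = {f | f = 0 on D}, so the annihilator of J is isometric to E^*.  It is an
   L-summand because J is cut out by multipliers 0 <= g_n <= 1 vanishing on D:
   its complement consists of the w with w(g_n f) -> w(f), and testing z + w on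
   (1 - g_n) x + g_n y yields |z + w| >= |z| + |w|. *)

Require Import Defs.
From HB Require Import structures.
From mathcomp Require Import all_boot all_order all_algebra.
From mathcomp Require Import complex.
From mathcomp Require Import all_classical all_reals all_analysis.
From mathcomp Require Import ring lra.

Import Order.TTheory GRing.Theory Num.Theory.
Import numFieldNormedType.Exports.

Local Open Scope classical_set_scope.
Local Open Scope ring_scope.

Set Implicit Arguments.
Unset Strict Implicit.

(** * Real and complex scalars *)

Section Scalars.
Context {R : realType} {k : scalar_kind}.
Local Notation K := (scalars R k).

Definition imag_part : K -> R :=
  match k return scalars R k -> R with
  | RealScalars => fun=> 0
  | ComplexScalars => fun x => complex.Im x
  end.

Definition of_parts : R -> R -> K :=
  match k return R -> R -> scalars R k with
  | RealScalars => fun a _ => a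
  | ComplexScalars => fun a b => Complex a b
  end.

Lemma of_partsK (x : K) : of_parts (real_part x) (imag_part x) = x.
Proof. by move: x; rewrite /of_parts /real_part /imag_part; case: k => // -[]. Qed.

Lemma real_partD (x y : K) : real_part (x + y) = real_part x + real_part y.
Proof. by move: x y; rewrite /real_part; case: k => //= -[a b] [c d]. Qed.

Lemma imag_partD (x y : K) : imag_part (x + y) = imag_part x + imag_part y.
Proof.
by move: x y; rewrite /imag_part; case: k => [x y|[a b] [c d]]//; rewrite addr0.
Qed.

Lemma real_partZ (a : R) (x : K) : real_part (of_real a * x) = a * real_part x.
Proof.
by move: x; rewrite /real_part /of_real; case: k => //= -[b c] /=; rewrite mul0r subr0.
Qed.

Lemma imag_partZ (a : R) (x : K) : imag_part (of_real a * x) = a * imag_part x.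
Proof.
move: x; rewrite /imag_part /of_real; case: k => /= [x|[b c]] /=.
  by rewrite mulr0.
by rewrite mul0r addr0.
Qed.

Lemma of_real1 : of_real 1 = 1 :> K.
Proof. by rewrite /of_real; case: k. Qed.

Lemma of_realN (x : R) : of_real (- x) = - of_real x :> K.
Proof. by apply/eqP; rewrite -addr_eq0 -of_realD addNr of_real0. Qed.

Lemma rnorm_of_real (a : R) : rnorm (of_real a : K^o) = `|a|.
Proof.
rewrite /rnorm; apply: (can_inj (@of_realK R k)).
rewrite real_partK ?normr_real//.
have [a0|a0] := leP 0 a.
  by rewrite !ger0_norm// -(of_real0 R k) ler_of_real.
by rewrite !ltr0_norm// ?of_realN// -(of_real0 R k) ltr_of_real.
Qed.

Lemma ler_real_part (x : K) : `|real_part x| <= rnorm (x : K^o).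
Proof.
rewrite /rnorm; move: x; rewrite /real_part; case: k => //= -[a b] /=.
by rewrite -sqrtr_sqr ler_wsqrtr// lerDl sqr_ge0.
Qed.

Lemma ler_imag_part (x : K) : `|imag_part x| <= rnorm (x : K^o).
Proof.
rewrite /rnorm; move: x; rewrite /real_part /imag_part; case: k => [x|[a b]].
  by rewrite normr0.
by rewrite /= -sqrtr_sqr ler_wsqrtr// lerDr sqr_ge0.
Qed.

Lemma ler_of_parts (a b : R) : rnorm (of_parts a b : K^o) <= `|a| + `|b|.
Proof.
rewrite /rnorm /of_parts /real_part; case: k => /=; first by rewrite lerDl.
rewrite -(@ger0_norm _ (`|a| + `|b|)) ?addr_ge0// -sqrtr_sqr ler_wsqrtr//.
by rewrite sqrrD !real_normK ?num_real// -addrA lerD2l lerDr// mulrn_wge0// mulr_ge0.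
Qed.

Lemma of_partsB (a b c d : R) :
  of_parts a b - of_parts c d = of_parts (a - c) (b - d).
Proof. by rewrite /of_parts; case: k. Qed.

(* [a] is [|x| / x]. *)
Lemma rotation (x : K) :
  exists2 a : K, rnorm (a : K^o) <= 1 & a * x = of_real (rnorm (x : K^o)).
Proof.
rewrite of_real_rnorm; have [->|x0] := eqVneq x 0.
  by exists 0; rewrite ?mulr0 ?normr0// -(ler_of_real k) of_real_rnorm normr0 of_real1.
exists (`|x : K^o| / x); last by rewrite divfK.
rewrite -(ler_of_real k) of_real_rnorm of_real1.
by rewrite [leLHS]normrM normfV normr_id divff// normr_eq0.
Qed.

(** Positive elements of [K] are the [of_real r] with r > 0, so limits can be tested with real
    radii. *)
Lemma cvg_rnormP {T : Type} {F : set_system T} {FF : Filter F}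
    {V : normedModType K} (f : T -> V) (v : V) :
  f @ F --> v <-> forall e : R, 0 < e -> \forall t \near F, rnorm (v - f t) < e.
Proof.
split=> [/cvgrPdist_lt fv e e0|fv].
  have /fv : 0 < of_real e :> K by rewrite -(of_real0 R k) ltr_of_real.
  by apply: filterS => t; rewrite -of_real_rnorm ltr_of_real.
apply/cvgrPdist_lt => e e0.
have eE : of_real (real_part e) = e by rewrite real_partK// gtr0_real.
have : 0 < real_part e by rewrite -(ltr_of_real k) of_real0 eE.
move=> /fv; apply: filterS => t; rewrite -(ltr_of_real k) eE.
by rewrite of_real_rnorm.
Qed.

Lemma near_rnorm {V : normedModType K} (v : V) (e : R) :
  0 < e -> \forall w \near v, rnorm (v - w) < e.
Proof. by move=> e0; have /cvg_rnormP := @cvg_id _ (nbhs v); apply. Qed.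

Lemma cvg_of_parts {T : Type} {F : set_system T} {FF : Filter F}
    (f g : T -> R) (a b : R) :
  f @ F --> a -> g @ F --> b ->
  (fun t => of_parts (f t) (g t) : K^o) @ F --> (of_parts a b : K^o).
Proof.
move=> fa gb; apply/cvg_rnormP => e e0; have e2 : 0 < e / 2 by rewrite divr_gt0.
move/cvgrPdist_lt : fa => /(_ _ e2) fa; move/cvgrPdist_lt : gb => /(_ _ e2) gb.
near=> t; rewrite of_partsB (le_lt_trans (ler_of_parts _ _))// [e]splitr ltrD//.
  by near: t.
by near: t.
Unshelve. all: by end_near. Qed.

Lemma cvg_of_real {T : Type} {F : set_system T} {FF : Filter F}
    (f : T -> R) (a : R) :
  f @ F --> a -> (fun t => of_real (f t) : K^o) @ F --> (of_real a : K^o).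
Proof.
move=> /cvgrPdist_lt fa; apply/cvg_rnormP => e /fa; apply: filterS => t.
by rewrite -of_realN -of_realD rnorm_of_real.
Qed.

Lemma rnormN (V : normedModType K) (v : V) : rnorm (- v) = rnorm v.
Proof. by rewrite /rnorm normrN. Qed.

Lemma rnorm_distC (V : normedModType K) (u v : V) : rnorm (u - v) = rnorm (v - u).
Proof. by rewrite -rnormN opprB. Qed.

Lemma rnormZr (V : normedModType K) (a : R) (v : V) :
  rnorm (of_real a *: v) = `|a| * rnorm v.
Proof. by rewrite rnormZ rnorm_of_real. Qed.

Lemma rnorm_zero (V : normedModType K) : rnorm (0 : V) = 0.
Proof. by apply: (can_inj (@of_realK R k)); rewrite of_real_rnorm normr0 of_real0. Qed.

End Scalars.

(** * Functionals recovered from their real parts *)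

Section Complexification.
Context {R : realType} {k : scalar_kind} {E : normedModType (scalars R k)}.
Local Notation K := (scalars R k).

(** [E] is a module over [K] only, so linearity over the reals is expressed through [of_real]. *)
Record real_linear (u : E -> R) : Prop := RealLinear {
  real_linearD : forall x y, u (x + y) = u x + u y;
  real_linearZ : forall (a : R) x, u (of_real a *: x) = a * u x }.

(** In the complex case f x = u x - i u (i x). For the bound, choose a with |a| <= 1 and a f(x) = |f
    x|; then |f x| = Re f(a x) = u (a x) <= |x|. *)
Lemma complexification (u : E -> R) :
  real_linear u -> (forall x, u x <= rnorm x) ->
  exists f : E -> K^o,
    [/\ linear f, forall x, rnorm (f x) <= rnorm x &
        forall x, real_part (f x) = u x].
Proof.
move=> [uD uZ] u_le.
suff [f [fl fu]] : exists f : E -> K^o, linear f /\ forall x, real_part (f x) = u x.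
  exists f; split => // x; have [a a1 ax] := rotation (f x).
  have fZ : f (a *: x) = a * f x.
    by have := fl a x 0; rewrite addr0 => ->; have := fl (-1) x x;
      rewrite scaleN1r addNr scaleN1r addNr => ->; rewrite addr0.
  rewrite -(of_realK k (rnorm (f x))) -ax -fZ fu (le_trans (u_le _))//.
  by rewrite rnormZ ler_piMl ?rnorm_ge0.
move: (E) u uD uZ {u_le}; rewrite /real_part /of_real /scalars.
case: (k) => V u uD uZ; first by exists u; split => [a x y|//]; rewrite uD uZ.
pose f (x : V) : R[i] := Complex (u x) (- u ('i *: x)).
have uN x : u (- x) = - u x.
  by have := uZ (-1) x; rewrite /= rmorphN1 scaleN1r mulN1r.
have fD x y : f (x + y) = f x + f y by rewrite /f scalerDr !uD opprD.
have fr a x : f (real_complex R a *: x) = real_complex R a * f x.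
  rewrite /f scalerA mulrC -scalerA !uZ; apply/eqP; rewrite eq_complex /=.
  by rewrite !mul0r subr0 addr0 mulrN; apply/andP; split; apply/eqP.
have fi x : f ('i *: x) = 'i * f x.
  rewrite /f scalerA -expr2 sqr_i scaleN1r uN; apply/eqP; rewrite eq_complex /=.
  by rewrite !mul0r !mul1r sub0r add0r !opprK; apply/andP; split; apply/eqP.
exists f; split => // -[a b] x y; rewrite fD; congr (_ + _).
have -> : (Complex a b : R[i]) = real_complex R a + 'i * real_complex R b.
  by apply/eqP; rewrite eq_complex /= !mul0r !mul1r !subr0 !addr0 !add0r !eqxx.
by rewrite scalerDl fD -scalerA fi !fr mulrA -mulrDl.
Qed.

End Complexification.

(** * The Hahn-Banach theorem *)

Section HahnBanach.
Context {R : realType} {k : scalar_kind} {E : normedModType (scalars R k)}.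
Local Notation K := (scalars R k).
Implicit Types p q : E -> R.

Record sublinear p : Prop := Sublinear {
  sublinearD : forall x y, p (x + y) <= p x + p y;
  sublinearZ : forall (a : R) x, 0 <= a -> p (of_real a *: x) = a * p x }.

Lemma sublinear0 p : sublinear p -> p 0 = 0.
Proof. by move=> [_ pZ]; rewrite -(scaler0 _ (of_real 0)) pZ// mul0r. Qed.

Lemma sublinearN p x : sublinear p -> - p (- x) <= p x.
Proof.
move=> sp; rewrite lerNl -subr_ge0 opprK -(sublinear0 sp) -(addNr x).
by rewrite sublinearD.
Qed.

(** The witness is q x = inf over t >= 0 of p (x + t y) - t p y, bounded below by - p (- x). Taking
    t = 0 gives q <= p; taking t = 1 at x = - y gives q (- y) <= - p y. *)
Lemma sublinear_shift p y : sublinear p -> exists q,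
  [/\ sublinear q, forall x, q x <= p x & q (- y) <= - p y].
Proof.
move=> sp; pose A x := [set p (x + of_real t *: y) - t * p y | t in [set t | 0 <= t]].
pose q x := inf (A x).
have A0 x : A x !=set0 by exists (p (x + of_real 0 *: y) - 0 * p y), 0 => /=.
have Ab x : has_lbound (A x).
  exists (- p (- x)) => _ [t /= t0 <-].
  rewrite lerBrDr addrC lerBlDr -sublinearZ//.
  by rewrite -{1}(addKr x (of_real t *: y)) addrC sublinearD.
have qA x t : 0 <= t -> q x <= p (x + of_real t *: y) - t * p y.
  by move=> t0; apply: ge_inf => //; exists t.
have qlb x c : (forall t, 0 <= t -> c <= p (x + of_real t *: y) - t * p y) -> c <= q x.
  by move=> cA; apply: lb_le_inf => // _ [t t0 <-]; exact: cA.
have qZ a x : 0 < a -> q (of_real a *: x) <= a * q x.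
  move=> a0; have a0W := ltW a0; rewrite -ler_pdivrMl//; apply: (qlb) => t t0.
  rewrite ler_pdivrMl// (le_trans (qA _ (a * t) _)) ?mulr_ge0//.
  by rewrite of_realM -scalerA -scalerDr sublinearZ// mulrBr mulrA.
exists q; split; first split.
- move=> x x'; rewrite -lerBlDr; apply: (qlb) => t t0; rewrite lerBlDl -lerBlDr.
  apply: (qlb) => t' t'0; rewrite lerBlDr (le_trans (qA _ (t + t') _)) ?addr_ge0//.
  have := sublinearD sp (x + of_real t *: y) (x' + of_real t' *: y).
  by rewrite addrACA -scalerDl -of_realD mulrDl; lra.
- move=> a x; rewrite le_eqVlt => /predU1P[<-|a0].
    rewrite of_real0 scale0r mul0r; apply/eqP; rewrite eq_le; apply/andP; split.
      by rewrite (le_trans (qA _ 0 _))// mul0r of_real0 scale0r addr0 subr0 sublinear0.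
    by apply: (qlb) => t t0; rewrite add0r sublinearZ// subrr.
  apply/eqP; rewrite eq_le qZ//= -ler_pdivlMl//.
  rewrite -[x in leLHS](scale1r x) -(@of_real1 R k) -(mulVf (lt0r_neq0 a0)).
  by rewrite of_realM -scalerA qZ// invr_gt0.
- by move=> x; rewrite (le_trans (qA _ 0 _))// mul0r of_real0 scale0r addr0 subr0.
- by rewrite (le_trans (qA _ 1 _))// mul1r of_real1 scale1r addNr sublinear0// sub0r.
Qed.

(** Zorn's lemma for the reversed pointwise order. A nonempty chain is bounded by its pointwise
    infimum, which is finite because a sublinear s <= p satisfies s x >= - s (- x) >= - p (- x); the
    empty chain is bounded by p. *)
Lemma minimal_sublinear p : sublinear p -> exists q,
  [/\ sublinear q, forall x, q x <= p x &
      forall r, sublinear r -> (forall x, r x <= q x) -> r = q].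
Proof.
move=> sp; pose S := {q : E -> R | sublinear q /\ forall x, q x <= p x}.
pose le (s t : S) := `[< forall x, sval t x <= sval s x >].
have [| | | |[q [sq qp]] qmin] := @Zorn S le.
- by move=> s; apply/asboolP.
- move=> r s t /asboolP rs /asboolP st; apply/asboolP => x.
  exact: le_trans (st x) (rs x).
- move=> s t /asboolP st /asboolP ts; apply: eq_sig_hprop.
    by move=> ?; exact: Prop_irrelevance.
  by apply/funext => x; apply/eqP; rewrite eq_le st ts.
- move=> A totA; have [[s0 As0]|A0] := pselect (A !=set0); last first.
    exists (exist _ p (conj sp (fun=> lexx _))) => s As; exfalso.
    by apply: A0; exists s.
  pose B x := [set sval s x | s in A]; pose q x := inf (B x).
  have B0 x : B x !=set0 by exists (sval s0 x), s0.
  have Bb x : has_lbound (B x).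
    exists (- p (- x)) => _ [s As <-]; case: (svalP s) => ss sp'.
    by rewrite (le_trans _ (sublinearN x ss))// lerN2.
  have qB x s : A s -> q x <= sval s x by move=> As; apply: ge_inf => //; exists s.
  have qlb x c : (forall s, A s -> c <= sval s x) -> c <= q x.
    by move=> cB; apply: lb_le_inf => // _ [s As <-]; exact: cB.
  have qZ a x : 0 < a -> q (of_real a *: x) <= a * q x.
    move=> a0; have a0W := ltW a0; rewrite -ler_pdivrMl//; apply: (qlb) => s As.
    rewrite ler_pdivrMl// (le_trans (qB _ _ As))//.
    by case: (svalP s) => ss _; rewrite sublinearZ.
  have sq : sublinear q.
    split.
    + move=> x y; rewrite -lerBlDr; apply: (qlb) => s As; rewrite lerBlDl -lerBlDr.
      apply: (qlb) => t At; rewrite lerBlDr.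
      (* Two members of a chain are comparable, so the smaller one, [t], handles both: q (x + y) <=
         t x + t y <= s x + t y. *)
      wlog st : s t x y As At / le s t.
        move=> hw; case: (totA _ _ As At) => [st|ts]; first exact: hw.
        by rewrite [x + y]addrC [leRHS]addrC; exact: hw.
      rewrite (le_trans (qB _ _ At))//; case: (svalP t) => st' _.
      rewrite (le_trans (sublinearD st' _ _))// addrC lerD//.
      by move/asboolP: st; exact.
    + move=> a x; rewrite le_eqVlt => /predU1P[<-|a0].
        rewrite of_real0 scale0r mul0r; apply/eqP; rewrite eq_le; apply/andP; split.
          by rewrite (le_trans (qB _ _ As0))// sublinear0//; case: (svalP s0).
        by apply: (qlb) => s _; rewrite sublinear0//; case: (svalP s).
      apply/eqP; rewrite eq_le qZ//= -ler_pdivlMl//.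
      rewrite -[x in leLHS](scale1r x) -(@of_real1 R k) -(mulVf (lt0r_neq0 a0)).
      by rewrite of_realM -scalerA qZ// invr_gt0.
  have qp x : q x <= p x by rewrite (le_trans (qB x _ As0))//; case: (svalP s0).
  by exists (exist _ q (conj sq qp)) => s As; apply/asboolP => x; exact: qB.
- exists q; split => // r sr rq.
  have rp x : r x <= p x by exact: le_trans (rq x) (qp x).
  by have := qmin (exist _ r (conj sr rp)) (asboolT rq) => /(congr1 sval).
Qed.

(* A minimal sublinear functional [q] equals its shifts, so [q (- y) <= - q y]
   for every [y]. *)
Lemma hahn_banach p : sublinear p -> exists2 u, real_linear u & forall x, u x <= p x.
Proof.
move=> /minimal_sublinear[q [sq qp qmin]]; exists q => //.
have qN y : q (- y) = - q y.
  have [r [sr rq ry]] := sublinear_shift y sq.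
  rewrite (qmin _ sr rq) in ry; apply/eqP; rewrite eq_le ry/=.
  by rewrite lerNl; have := sublinearN (- y) sq; rewrite opprK; lra.
split=> [x y|a x].
  apply/eqP; rewrite eq_le sublinearD//=.
  by have := sublinearD sq (- x) (- y); rewrite -opprD !qN; lra.
have [a0|a0] := leP 0 a; first exact: sublinearZ.
rewrite -[a]opprK of_realN scaleNr qN sublinearZ ?mulNr//.
by rewrite oppr_ge0 ltW.
Qed.

(** A real-linear functional u below the shift of the norm at x satisfies u (- x) <= - |x|, that is,
    u x >= |x|. *)
Lemma norming_functional (x : E) : exists u : E -> R,
  [/\ real_linear u, forall y, u y <= rnorm y & u x = rnorm x].
Proof.
have sn : sublinear (@rnorm R k E).
  by split=> [y z|a y a0]; [exact: ler_rnormD|rewrite rnormZr ger0_norm].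
have [q [sq qn qx]] := sublinear_shift x sn.
have [u ul uq] := hahn_banach sq.
have un y : u y <= rnorm y by exact: le_trans (uq y) (qn y).
exists u; split => //; apply/eqP; rewrite eq_le un/=.
have := le_trans (uq (- x)) qx.
by rewrite -scaleN1r -of_real1 -of_realN (real_linearZ ul) mulN1r lerN2.
Qed.

End HahnBanach.

(** * Digit expansions and a Cantor set *)

Section Expansion.
Context {R : realType}.
Implicit Types (b : R) (x : nat -> R).

(* The weights [b ^- m - b ^- m.+1] telescope to 1 and equal
   [(b - 1) / b ^+ m.+1]. *)
Definition digit_sum b x (n : nat) : R :=
  \sum_(m < n) x m * (b ^- m - b ^- m.+1).

(** Digits may be any reals in [0, 1], so that continuous functions can serve as digits. For b > 1
    the partial sums are then nondecreasing, and the supremum is the sum of the series. *)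
Definition expansion b x : R := sup (range (digit_sum b x)).

Lemma digit_sumS b x n :
  digit_sum b x n.+1 = digit_sum b x n + x n * (b ^- n - b ^- n.+1).
Proof. by rewrite /digit_sum big_ord_recr. Qed.

Lemma digit_sum_bounds b x m n : 1 < b -> (forall i, 0 <= x i <= 1) -> (m <= n)%N ->
  digit_sum b x m <= digit_sum b x n <= digit_sum b x m + (b ^- m - b ^- n).
Proof.
move=> b1 x01; elim: n => [|n IH].
  by rewrite leqn0 => /eqP ->; rewrite subrr addr0 lexx.
rewrite leq_eqVlt => /predU1P[->|]; first by rewrite subrr addr0 lexx.
rewrite ltnS => /IH; have := x01 n; rewrite digit_sumS.
have : 0 <= b ^- n - b ^- n.+1.
  rewrite subr_ge0 lef_pV2 ?posrE ?exprn_gt0 ?(lt_trans ltr01)//.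
  by rewrite ler_weXn2l// ltW.
by nra.
Qed.

Lemma expansion_bounds b x n : 1 < b -> (forall i, 0 <= x i <= 1) ->
  digit_sum b x n <= expansion b x <= digit_sum b x n + b ^- n.
Proof.
move=> b1 x01; have b0 m : 0 <= b ^- m.
  by rewrite invr_ge0 exprn_ge0// ltW// (lt_trans ltr01).
have ub m : digit_sum b x m <= digit_sum b x n + b ^- n.
  have [mn|/ltnW nm] := leqP m n.
    by have := digit_sum_bounds b1 x01 mn; have := b0 n; lra.
  by have := digit_sum_bounds b1 x01 nm; have := b0 m; lra.
apply/andP; split.
  apply: ub_le_sup; last by exists n.
  by exists (digit_sum b x n + b ^- n) => _ [m _ <-].
apply: ge_sup; first by exists (digit_sum b x 0), 0%N.
by move=> _ [m _ <-].
Qed.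

Lemma expr_inv_small b (e : R) : 1 < b -> 0 < e -> exists n, b ^- n < e.
Proof.
move=> b1 e0; have b0 : 0 < b by rewrite (lt_trans ltr01).
have : (b^-1) ^+ n @[n --> \oo] --> (0 : R).
  by apply: cvg_expr; rewrite gtr0_norm ?invr_gt0// invf_lt1.
move=> /cvgrPdist_lt/(_ _ e0)[n _ /(_ n (leqnn _))].
rewrite sub0r normrN exprVn ger0_norm ?invr_ge0 ?exprn_ge0 ?ltW// => h.
by exists n.
Qed.

Lemma expansion_unique b x y : 1 < b -> (forall i, 0 <= x i <= 1) ->
  (forall n, digit_sum b x n <= y <= digit_sum b x n + b ^- n) -> expansion b x = y.
Proof.
move=> b1 x01 yb; apply/eqP/negPn/negP => ne.
have [n] : exists n, b ^- n < `|expansion b x - y|.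
  by apply: expr_inv_small => //; rewrite normr_gt0 subr_eq0.
apply/negP; rewrite -leNgt ler_distl.
by have := expansion_bounds n b1 x01; have := yb n; lra.
Qed.

(** By [expansion_bounds] the first n digits determine the value up to b^-n uniformly in t, so this
    is a uniform limit of continuous functions. *)
Lemma continuous_expansion (T : topologicalType) b (x : nat -> T -> R) :
  1 < b -> (forall i t, 0 <= x i t <= 1) -> (forall i, continuous (x i)) ->
  continuous (fun t => expansion b (x^~ t)).
Proof.
move=> b1 x01 xc t; apply/cvgrPdist_lt => e e0.
have [n ne] : exists n, b ^- n < e / 2 by apply: expr_inv_small; rewrite ?divr_gt0.
have sc : continuous (fun t => digit_sum b (x^~ t) n).
  rewrite /digit_sum; elim: n {ne} => [|n IH] s.
    by under eq_fun do rewrite big_ord0; exact: cvg_cst.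
  under eq_fun do rewrite big_ord_recr.
  by apply: cvgD; [exact: IH|apply: cvgMr_tmp; exact: xc].
have /cvgrPdist_lt/(_ (e / 2)) := sc t; rewrite divr_gt0// => /(_ isT).
apply: filterS => s; rewrite !ltr_distl => st.
have := expansion_bounds n b1 (x01^~ t); have := expansion_bounds n b1 (x01^~ s).
by lra.
Qed.

Lemma binary_expansion (y : R) : 0 <= y <= 1 ->
  exists d : nat -> bool, expansion 2 (fun m => (d m)%:R) = y.
Proof.
move=> y01.
(* [f n] is the remainder after n digits, scaled by 2^n; the next digit is 1 when it is at least
   1/2. Hence y is the n-th partial sum plus f n / 2^n. *)
pose f := fix f n : R := if n is n'.+1 then
  let r := f n' in 2 * r - (1 / 2 <= r)%R%:R else y.
have f01 n : 0 <= f n <= 1.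
  by elim: n => //= n; case: (leP (1 / 2) (f n)); rewrite ?mulr1n ?mulr0n /=; lra.
exists (fun n => 1 / 2 <= f n); apply: expansion_unique; first by rewrite ltr1n.
  by move=> i /=; case: (1 / 2 <= f i); rewrite ?lexx ler01.
move=> n; suff -> : y = digit_sum 2 (fun m => (1 / 2 <= f m)%R%:R) n + f n / 2 ^+ n.
  have : 0 < 2 ^- n :> R by rewrite invr_gt0 exprn_gt0.
  by have := f01 n; nra.
elim: n => [|n IH]; first by rewrite /digit_sum big_ord0 add0r expr0 divr1.
rewrite {1}IH digit_sumS -addrA; congr (_ + _) => /=.
have : 2 ^+ n != 0 :> R by rewrite expf_neq0.
by rewrite exprS; move: (2 ^+ n : R) ((1 / 2 <= f n)%R%:R : R) => z d z0; field.
Qed.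

End Expansion.

(** * A Cantor set whose digits are read off by cosines *)

Section CosineDigits.
Context {R : realType}.

Definition wave (j : nat) (t : R) : R := cos (8 ^+ j * t * (pi *+ 2)).

Definition cos_gap : R := cos (pi / 4).

(** An affine function of the wave, truncated to [0, 1]. It is 1 where [wave j t <= - cos_gap] and 0
    where [wave j t >= cos_gap]: continuous everywhere, and a binary digit on [cosine_cantor]. *)
Definition cosine_digit (j : nat) (t : R) : R :=
  Num.max 0 (Num.min 1 (1 / 2 - wave j t / (2 * cos_gap))).

Definition cosine_cantor : set R := [set t | forall j, cos_gap <= `|wave j t|].

Lemma cos_gap_gt0 : 0 < cos_gap.
Proof. by apply: cos_gt0_pihalf; have := pi_gt0 R; lra. Qed.

Lemma cos_gap_le (r : R) : 0 <= r <= 1 / 8 -> cos_gap <= cos (r * (pi *+ 2)).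
Proof.
move=> r01; have p0 := pi_gt0 R; rewrite leNgt ltr_cos ?in_itv/= -?leNgt.
- by rewrite mulr2n; nra.
- by lra.
- by rewrite mulr2n; nra.
Qed.

Lemma continuous_wave j : continuous (wave j).
Proof.
rewrite /wave => t; apply: (@continuous_cvg _ _ _ _ _ _ (@cos R)).
  exact: continuous_cos.
by apply: cvgMr_tmp; apply: cvgMl_tmp; exact: cvg_id.
Qed.

Lemma closed_cosine_cantor : closed cosine_cantor.
Proof.
rewrite (_ : cosine_cantor =
    \bigcap_j (fun t => `|wave j t|) @^-1` [set y | cos_gap <= y]).
  apply: closed_bigI => j _; apply: preimage_closed; last exact: closed_ge.
  by move=> t _; apply: cvg_norm; exact: continuous_wave.
by apply/seteqP; split=> [t ct j _|t ct j]; [exact: ct|exact: ct].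
Qed.

Lemma cosine_digit01 j t : 0 <= cosine_digit j t <= 1.
Proof. by rewrite /cosine_digit le_max lexx ge_max ler01 ge_min lexx. Qed.

Lemma continuous_cosine_digit j : continuous (cosine_digit j).
Proof.
suff : continuous (cst 0 \max
    (cst 1 \min (fun t => 1 / 2 - wave j t / (2 * cos_gap)) : R -> R)).
  by [].
apply: max_fun_continuous; first by move=> t; exact: cvg_cst.
apply: min_fun_continuous; first by move=> t; exact: cvg_cst.
move=> t; apply: cvgB; first exact: cvg_cst.
by apply: cvgMr_tmp; exact: continuous_wave.
Qed.

(** This makes [cosine_cantor] nowhere dense, since a zero of any wave lies outside it. With 8^j (b
    - a) > 2 and n the integer part of 8^j a, the point (n + 1 + 1/4) / 8^j lies between a and b,
    and the angle there is pi / 2 modulo 2 pi. *)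
Lemma wave_zero (a b : R) : 0 <= a -> a < b ->
  exists j t, [/\ a < t, t < b & wave j t = 0].
Proof.
move=> a0 ab; have [j jab] : exists j, 8 ^- j < (b - a) / 2 :> R.
  by apply: expr_inv_small; [rewrite ltr1n|rewrite divr_gt0// subr_gt0].
have e0 : 0 < 8 ^+ j :> R by rewrite exprn_gt0.
have /truncn_itv : 0 <= 8 ^+ j * a by rewrite mulr_ge0// ltW.
set n := Num.truncn _ => /andP[nl nr].
exists j, ((n.+1%:R + 1 / 4) / 8 ^+ j); split.
- by rewrite ltr_pdivlMr// mulrC; lra.
- rewrite ltr_pdivrMr//; move: jab; rewrite -[ltLHS]mul1r ltr_pdivrMr// => jab.
  by move: nl nr jab; rewrite -natr1; nra.
- rewrite /wave [8 ^+ j * _]mulrC divfK ?gt_eqF//.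
  rewrite (_ : _ * _ = pi / 2 + pi *+ 2 *+ n.+1).
    by rewrite (periodicn (@cosD2pi R)) cos_pihalf.
  by rewrite -[in RHS](mulr_natl _ n.+1) mulr2n; move: (n.+1%:R : R) => N; field.
Qed.

(** The point is the sum of the 4 d_m / 8^(m+1). Modulo integers, 8^j t is d_j / 2 + r with a tail 0
    <= r <= 1/8, so [wave j t] is cos (2 pi r) up to the sign (-1)^(d_j), and cos (2 pi r) >=
    [cos_gap]. *)
Lemma cosine_digits (d : nat -> bool) : exists t : R,
  [/\ 0 <= t <= 1, cosine_cantor t & forall j, cosine_digit j t = (d j)%:R].
Proof.
pose s n := digit_sum 8 (fun m => (d m)%:R : R) n.
have d01 m : 0 <= ((d m)%:R : R) <= 1 by case: (d m); rewrite ?lexx ler01.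
have b1 : 1 < 8 :> R by rewrite ltr1n.
have bnd := expansion_bounds _ b1 d01.
(* The weights in base 8 are 7 / 8^(m+1). The factor 4/7 turns them into 4 / 8^(m+1), so digit j
   contributes d_j / 2 to 8^j t and the earlier digits contribute integers. *)
set t' := expansion _ _ in bnd; pose t := 4 / 7 * t'.
have si j : exists n : nat, 8 ^+ j * (4 / 7 * s j) = n%:R.
  elim: j => [|j [n IH]]; first by exists 0%N; rewrite /s /digit_sum big_ord0 !mulr0.
  exists (8 * n + 4 * d j)%N; rewrite /s digit_sumS natrD !natrM -IH !exprS /s.
  have : 8 ^+ j != 0 :> R by rewrite expf_neq0.
  by move: (8 ^+ j : R) ((d j)%:R : R) => z q z0; field.
have wE j : exists2 r : R, 0 <= r <= 1 / 8 &
    wave j t = cos ((r + (d j)%:R / 2) * (pi *+ 2)).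
  have [n sn] := si j; exists (8 ^+ j * t - n%:R - (d j)%:R / 2).
    have := bnd j.+1; rewrite -/(s _) /s digit_sumS -/(s j) -sn /t exprS.
    have : 8 ^+ j != 0 :> R by rewrite expf_neq0.
    have : 0 < 8 ^+ j :> R by rewrite exprn_gt0.
    move: (8 ^+ j : R) ((d j)%:R : R) (s j) => z q S z0 z1.
    rewrite invfM; move=> /andP[h1 h2].
    have e1 : z * z^-1 = 1 by rewrite mulfV.
    have h3 : z * (S + q * (z^-1 - 8^-1 * z^-1)) <= z * t' by rewrite ler_wpM2l// ltW.
    have h4 : z * t' <= z * (S + q * (z^-1 - 8^-1 * z^-1) + 8^-1 * z^-1).
      by rewrite ler_wpM2l// ltW.
    have e2 : z * (S + q * (z^-1 - 8^-1 * z^-1)) = z * S + q * (7 / 8) by field.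
    have e3 : z * (S + q * (z^-1 - 8^-1 * z^-1) + 8^-1 * z^-1) =
        z * S + q * (7 / 8) + 1 / 8 by field.
    by rewrite e2 in h3; rewrite e3 in h4; lra.
  rewrite subrK /wave mulrBl [_ * (pi *+ 2) - _]addrC.
  rewrite -[in RHS](periodicn (@cosD2pi R) n); congr cos.
  by rewrite mulr_natl; ring.
have wg j : cos_gap <= (if d j then -1 else 1) * wave j t.
  have [r r01 ->] := wE j; case: (d j).
    rewrite (_ : _ * _ = r * (pi *+ 2) + pi); last by rewrite mulr2n /= mulr1n; field.
    by rewrite cosDpi mulN1r opprK cos_gap_le.
  by rewrite mul0r addr0 mul1r cos_gap_le.
have c0 := cos_gap_gt0.
exists t; split.
- by have := bnd 0%N; rewrite /digit_sum big_ord0 expr0 invr1 /t; lra.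
- move=> j; have := wg j; case: (d j) => h; rewrite (le_trans h)//.
    by rewrite mulN1r -normrN ler_norm.
  by rewrite mul1r ler_norm.
- move=> j; rewrite /cosine_digit; have := wg j; case: (d j) => /= h.
    have : wave j t / (2 * cos_gap) <= - (1 / 2).
      by rewrite ler_pdivrMr ?mulr_gt0//; lra.
    by move=> hv; rewrite min_l ?max_r//; lra.
  have : 1 / 2 <= wave j t / (2 * cos_gap).
    by rewrite ler_pdivlMr ?mulr_gt0//; lra.
  by move=> hv; rewrite max_l// ge_min subr_le0 hv orbT.
Qed.

End CosineDigits.

(** * Coding functionals by points of the interval *)

Section Coding.
Context {R : realType} {k : scalar_kind} {E : normedModType (scalars R k)}.
Variable e : nat -> E.
Hypothesis e_dense : forall (x : E) (r : R), 0 < r -> exists n, rnorm (x - e n) < r.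
Implicit Types c : nat -> R.

(** By the next two lemmas these are the sequences of values at the e_n of real-linear functionals
    of norm at most 1. Weak inequalities in three coordinates each make the condition closed in
    c. *)
Definition compatible c := forall (a b : R) n m l,
  `|a * c n + b * c m - c l| <=
    rnorm (of_real a *: e n + of_real b *: e m - e l).

Lemma real_linear_compatible u : real_linear u -> (forall x, u x <= rnorm x) ->
  compatible (u \o e).
Proof.
move=> [uD uZ] un a b n m l.
have uN x : u (- x) = - u x by rewrite -scaleN1r -of_real1 -of_realN uZ mulN1r.
have -> : a * (u \o e) n + b * (u \o e) m - (u \o e) l =
    u (of_real a *: e n + of_real b *: e m - e l) by rewrite /= !uD uN !uZ.
by rewrite ler_norml un andbT lerNl -uN -rnormN un.
Qed.

(* McShane's formula extends [c] to a function on [E] satisfying the same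
   Lipschitz bound. *)
Lemma compatible_extension c : compatible c -> exists u : E -> R,
  [/\ real_linear u, forall x, u x <= rnorm x & forall n, u (e n) = c n].
Proof.
move=> cc; pose A x := range (fun n => c n + rnorm (x - e n)).
pose u x := inf (A x).
have c_lip n m : c n - c m <= rnorm (e n - e m).
  (* The choice a = 1, b = 0 shows that c is 1-Lipschitz on the e_n. *)
  have := cc 1 0 n n m; rewrite !mul1r mul0r addr0 of_real1 of_real0.
  rewrite scale1r scale0r addr0.
  exact/le_trans/ler_norm.
have Ab x : has_lbound (A x).
  exists (c 0%N - rnorm (x - e 0%N)) => _ [n _ <-].
  have := c_lip 0%N n; have := ler_rnormD (e 0%N - x) (x - e n).
  by rewrite addrA subrK (rnorm_distC (e 0%N) x); lra.
have uA x n : u x <= c n + rnorm (x - e n) by apply: ge_inf => //; exists n.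
have ulb x r : (forall n, r <= c n + rnorm (x - e n)) -> r <= u x.
  move=> h; apply: lb_le_inf; first by exists (c 0%N + rnorm (x - e 0%N)), 0%N.
  by move=> _ [n _ <-].
have u_lip x y : u x - u y <= rnorm (x - y).
  rewrite lerBlDl -lerBlDr; apply: ulb => n; have := uA x n.
  have := ler_rnormD (x - y) (y - e n); rewrite addrA subrK; lra.
have ue n : u (e n) = c n.
  apply/eqP; rewrite eq_le; apply/andP; split.
    by have := uA (e n) n; rewrite subrr rnorm_zero addr0.
  by apply: ulb => m; have := c_lip n m; lra.
have u_dist x y : `|u x - u y| <= rnorm (x - y).
  by rewrite ler_norml u_lip andbT; have := u_lip y x; rewrite rnorm_distC; lra.
have ucomb a b x y : u (of_real a *: x + of_real b *: y) = a * u x + b * u y.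
  set z := _ + _; apply/eqP; rewrite eq_sym -subr_eq0 -normr_le0.
  apply/ler_addgt0Pr => r r0; rewrite add0r.
  (* With x, y and their combination z within s of e_n, e_m and e_l, an error of (|a| + |b| + 1) s
     occurs twice: from the Lipschitz bound on u, and from [compatible] at the nearby points. *)
  pose C := 2 * (`|a| + `|b| + 1).
  have C0 : 0 < C by rewrite mulr_gt0// ltr_wpDl// addr_ge0.
  pose s := r / C; have s0 : 0 < s by rewrite divr_gt0.
  have -> : r = C * s by rewrite /s mulrC divfK// gt_eqF.
  have [n xn] := e_dense x s0; have [m ym] := e_dense y s0; have [l zl] := e_dense z s0.
  have h1 := cc a b n m l.
  have -> : a * u x + b * u y - u z = a * (u x - c n) + b * (u y - c m) - (u z - c l)
    + (a * c n + b * c m - c l) by ring.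
  have h2 : rnorm (of_real a *: e n + of_real b *: e m - e l) <= (`|a| + `|b| + 1) * s.
    have -> : of_real a *: e n + of_real b *: e m - e l =
       of_real a *: (e n - x) + of_real b *: (e m - y) + (z - e l).
      rewrite /z !scalerBr.
      by rewrite [X in _ = X + _]addrACA -opprD [RHS]addrA subrK.
    rewrite (le_trans (ler_rnormD _ _))// mulrDl mul1r lerD ?(ltW zl)//.
    rewrite (le_trans (ler_rnormD _ _))// mulrDl !rnormZr lerD// ler_wpM2l//.
      by rewrite rnorm_distC ltW.
    by rewrite rnorm_distC ltW.
  have hx : `|a * (u x - c n)| <= `|a| * s.
    by rewrite normrM ler_wpM2l// -ue (le_trans (u_dist _ _))// ltW.
  have hy : `|b * (u y - c m)| <= `|b| * s.
    by rewrite normrM ler_wpM2l// -ue (le_trans (u_dist _ _))// ltW.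
  have hz : `|u z - c l| <= s by rewrite -ue (le_trans (u_dist _ _))// ltW.
  rewrite (le_trans (ler_normD _ _))//.
  have := ler_normB (a * (u x - c n) + b * (u y - c m)) (u z - c l).
  have := ler_normD (a * (u x - c n)) (b * (u y - c m)).
  by rewrite /C; lra.
have u0 : u 0 = 0.
  by have := ucomb 0 0 0 0; rewrite of_real0 !scale0r addr0 !mul0r addr0.
exists u; split=> //.
  split=> [x y|a x]; first by have := ucomb 1 1 x y; rewrite of_real1 !scale1r !mul1r.
  by have := ucomb a 0 x 0; rewrite of_real0 scale0r addr0 mul0r addr0.
by move=> x; have := u_lip x 0; rewrite u0 !subr0.
Qed.

(** [pickle] splits the digits of t into countably many sequences. The n-th is the binary expansion
    of a number in [0, 1], rescaled to [-|e_n|, |e_n|], where functionals of norm at most 1 take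
    their value at e_n. *)
Definition coded_coordinate (n : nat) (t : R) : R :=
  rnorm (e n) * (2 * expansion 2 (fun m => cosine_digit (pickle (n, m)) t) - 1).

Definition code_set : set R :=
  `[0, 1] `&` cosine_cantor `&` [set t | compatible (coded_coordinate^~ t)].

Lemma continuous_coded_coordinate n : continuous (coded_coordinate n).
Proof.
move=> t; apply: cvgMl_tmp; apply: cvgB; last exact: cvg_cst.
apply: cvgMl_tmp; apply: continuous_expansion; first by rewrite ltr1n.
  by move=> i s; exact: cosine_digit01.
by move=> i; exact: continuous_cosine_digit.
Qed.

Lemma closed_code_set : closed code_set.
Proof.
apply: closedI.
  by apply: closedI; [exact: interval_closed|exact: closed_cosine_cantor].
pose f (q : R * R * (nat * nat * nat)) t :=
  `|q.1.1 * coded_coordinate q.2.1.1 t + q.1.2 * coded_coordinate q.2.1.2 t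
    - coded_coordinate q.2.2 t|.
rewrite (_ : [set t | _] = \bigcap_q f q @^-1`
  [set r | r <= rnorm (of_real q.1.1 *: e q.2.1.1 + of_real q.1.2 *: e q.2.1.2
    - e q.2.2)]).
  apply: closed_bigI => q _; apply: preimage_closed; last exact: closed_le.
  move=> t _; apply: cvg_norm; apply: cvgB; last exact: continuous_coded_coordinate.
  by apply: cvgD; apply: cvgMl_tmp; exact: continuous_coded_coordinate.
apply/seteqP; split=> [t tc q _|t tc a b n m l]; first exact: tc.
exact: (tc (a, b, (n, m, l))).
Qed.

Lemma coded_functional u : real_linear u -> (forall x, u x <= rnorm x) ->
  exists2 t, code_set t & forall n, coded_coordinate n t = u (e n).
Proof.
move=> ul un.
have /choice[y yE] : forall n, exists y : R,
    0 <= y <= 1 /\ rnorm (e n) * (2 * y - 1) = u (e n).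
  move=> n; have := un (e n); have := un (- e n).
  rewrite -scaleN1r -of_real1 -of_realN (real_linearZ ul).
  rewrite of_realN of_real1 scaleN1r rnormN.
  rewrite mulN1r; have := rnorm_ge0 (e n); rewrite le_eqVlt => /predU1P[<-|e0] h1 h2.
    by exists 0; rewrite lexx ler01 mul0r; split => //; lra.
  exists ((u (e n) / rnorm (e n) + 1) / 2); split; last by field; rewrite gt_eqF.
  have : u (e n) / rnorm (e n) <= 1 by rewrite ler_pdivrMr// mul1r.
  have : -1 <= u (e n) / rnorm (e n) by rewrite ler_pdivlMr// mulN1r; lra.
  by lra.
have /choice[d dE] n := binary_expansion (yE n).1.
(* Digit (n, m) of t is the m-th binary digit of the n-th rescaled value; an index that codes no
   pair gets digit 0. *)
pose d' j := if unpickle j is Some (n, m) then d n m else false.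
have [t [t01 tc td]] := cosine_digits d' (R := R).
have tE n : coded_coordinate n t = u (e n).
  rewrite /coded_coordinate -(yE n).2; congr (_ * (_ * _ - _)).
  rewrite -dE; congr expansion; apply/funext => m.
  by rewrite td /d' pickleK.
exists t => //; split; first by split => //=; rewrite in_itv.
move=> a b n m l; rewrite /= !tE; exact: real_linear_compatible.
Qed.

(** A point t of [code_set] yields the functional with the coded values, by [compatible_extension].
    A norming functional for x has a code, and the functional of that code agrees with it by density
    of the e_n. Continuity in t at a fixed x reduces to that of one coordinate with e_n near x, all
    the functionals being 1-Lipschitz. *)
Theorem functional_coding : exists u : R -> E -> R,
  [/\ forall t, code_set t -> real_linear (u t) /\ forall x, u t x <= rnorm x,
      forall x, exists2 t, code_set t & u t x = rnorm x &
      forall x t (r : R), code_set t -> 0 < r ->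
        \forall s \near t, code_set s -> `|u t x - u s x| < r].
Proof.
have /choice[u uE] : forall t, exists u : E -> R, code_set t ->
    [/\ real_linear u, forall x, u x <= rnorm x &
        forall n, u (e n) = coded_coordinate n t].
  move=> t; have [tD|tD] := pselect (code_set t); last by exists (fun=> 0).
  by have [u ?] := compatible_extension tD.2; exists u.
have u_dist t x y : code_set t -> `|u t x - u t y| <= rnorm (x - y).
  move=> /uE[[uD uZ] un _].
  have uN z : u t (- z) = - u t z by rewrite -scaleN1r -of_real1 -of_realN uZ mulN1r.
  by rewrite -uN -uD ler_norml un andbT lerNl -uN -rnormN un.
exists u; split.
- by move=> t /uE[].
- move=> x; have [v [vl vn vx]] := norming_functional x.
  have [t tD tv] := coded_functional vl vn; exists t => //; rewrite -vx.
  have [[uD uZ] un ue] := uE t tD.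
  have vN z : v (- z) = - v z.
    by rewrite -scaleN1r -of_real1 -of_realN (real_linearZ vl) mulN1r.
  apply/eqP; rewrite -subr_eq0 -normr_le0; apply/ler_addgt0Pr => r r0; rewrite add0r.
  have [n xn] : exists n, rnorm (x - e n) < r / 2 by apply: e_dense; rewrite divr_gt0.
  have h1 := u_dist _ x (e n) tD.
  have h2 : `|v (e n) - v x| <= rnorm (x - e n).
    rewrite distrC -vN -(real_linearD vl) ler_norml vn andbT lerNl -vN -rnormN.
    exact: vn.
  rewrite (le_trans (ler_distD (v (e n)) _ _))// -tv -ue.
  by rewrite -tv -ue in h2; lra.
- move=> x t r tD r0; have r4 : 0 < r / 4 by rewrite divr_gt0.
  have [n xn] := e_dense x r4.
  have /cvgrPdist_lt/(_ _ r4) := @continuous_coded_coordinate n t.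
  apply: filterS => s ts sD.
  have h1 := u_dist _ x (e n) tD; have h2 := u_dist _ (e n) x sD.
  have [_ _ ut] := uE _ tD; have [_ _ us] := uE _ sD.
  have := ler_distD (u t (e n)) (u t x) (u s x).
  have := ler_distD (u s (e n)) (u t (e n)) (u s x).
  move: ts h2; rewrite -ut -us rnorm_distC; lra.
Qed.

End Coding.

(** * Dual spaces and annihilators *)

Section ClosedSubspaceOfSet.
Context {K : numFieldType} {V : normedModType K}.
Variables (S : set V) (S_submod : submod_closed (mem S)) (S_closed : closed S).

Let S_pred : submodClosed V :=
  HB.pack (mem S : {pred V}) (GRing.isSubmodClosed.Build K V (mem S) S_submod).

Let S_predE : [set` S_pred] = S.
Proof. by apply/seteqP; split => v; rewrite /= inE. Qed.

Definition closed_subspace_of_set : closed_subspace V :=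
  @ClosedSubspace K V S_pred (eq_ind_r closed S_closed S_predE).

Lemma closed_subspace_of_setP v : (v \in closed_subspace_of_set) <-> S v.
Proof. by rewrite -[X in _ <-> X v]S_predE. Qed.

End ClosedSubspaceOfSet.

Section DualNorm.
Context {R : realType} {k : scalar_kind} {V : normedModType (scalars R k)}.
Local Notation K := (scalars R k).
Implicit Types f g : dual_space V.

Lemma closed_unit_ballE (v : V) : closed_unit_ball v <-> rnorm v <= 1.
Proof. by rewrite /closed_unit_ball /= -of_real_rnorm -(of_real1 (R:=R)) ler_of_real. Qed.

Lemma rnorm_dual f : rnorm f = rsup (@closed_unit_ball R k V) (val f).
Proof. exact: of_realK. Qed.

Lemma dual_linear f : linear (val f).
Proof. by have /set_mem[] := valP f. Qed.

Lemma dual_continuous f : continuous (val f).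
Proof. by have /set_mem[] := valP f. Qed.

Lemma dualD f u v : val f (u + v) = val f u + val f v.
Proof. by have := dual_linear f 1 u v; rewrite !scale1r. Qed.

Lemma dual0 f : val f 0 = 0.
Proof. by have := dualD f 0 0; rewrite addr0 -{1}[val f 0]addr0 => /addrI. Qed.

Lemma dualZ f a v : val f (a *: v) = a *: val f v.
Proof. by have := dual_linear f a v 0; rewrite dual0 !addr0. Qed.

Lemma dualN f v : val f (- v) = - val f v.
Proof. by rewrite -scaleN1r dualZ scaleN1r. Qed.

Lemma dualB f u v : val f (u - v) = val f u - val f v.
Proof. by rewrite dualD dualN. Qed.

Lemma dual_norm_le f M : 0 <= M ->
  (forall v, rnorm v <= 1 -> rnorm (val f v) <= M) -> rnorm f <= M.
Proof.
by move=> M0 fM; rewrite rnorm_dual; apply: rsup_le => // v /closed_unit_ballE/fM.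
Qed.

Lemma dual_norm_ge f v : rnorm v <= 1 -> rnorm (val f v) <= rnorm f.
Proof.
move=> v1; rewrite rnorm_dual rsup_ub//; first exact: dual_rbounded.
exact/closed_unit_ballE.
Qed.

Lemma dual_norm_bound f v : rnorm (val f v) <= rnorm f * rnorm v.
Proof.
have [v0|] := leP (rnorm v) 0.
  have -> : v = 0 by apply/rnorm_eq0/eqP; rewrite eq_le v0 rnorm_ge0.
  by rewrite dual0 !rnorm_zero mulr0.
move=> v0; rewrite -ler_pdivrMr// mulrC.
rewrite -{1}[(rnorm v)^-1]ger0_norm ?invr_ge0 ?rnorm_ge0//.
rewrite -rnormZr -dualZ dual_norm_ge// rnormZr ger0_norm ?invr_ge0 ?rnorm_ge0//.
by rewrite mulVf// gt_eqF.
Qed.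

Lemma bounded_is_dual (h : V -> K^o) (M : R) : linear h ->
  (forall v, rnorm (h v) <= M * rnorm v) -> h \in @is_dual R k V.
Proof.
move=> hl hM; rewrite inE; split=> // v; apply/cvg_rnormP => r r0.
have M0 : 0 < `|M| + 1 by rewrite ltr_wpDl.
have := near_rnorm v (divr_gt0 r0 M0); apply: filterS => w vw.
have -> : h v - h w = h (v - w) by rewrite addrC -scaleN1r -hl scaleN1r addrC.
rewrite (le_lt_trans (hM _))//; move: vw; rewrite ltr_pdivlMr//.
by have := rnorm_ge0 (v - w); have := ler_norm M; nra.
Qed.

Definition dual_of (h : V -> K^o) (M : R) (hl : linear h)
    (hM : forall v, rnorm (h v) <= M * rnorm v) : dual_space V :=
  Sub h (bounded_is_dual hl hM).

Lemma annihilator_submod_closed (J : set V) :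
  submod_closed (mem [set f : dual_space V | forall v, J v -> val f v = 0]).
Proof.
split=> [|a f g]; rewrite !inE //= => f0 g0 v Jv.
by rewrite /= !fctE /= f0// g0// scaler0 addr0.
Qed.

Lemma closure_approx (f : dual_space V) (v : V) (S : set (dual_space V)) (r : R) :
  closure S f -> 0 < r -> exists2 g, S g & rnorm (f - g) < r.
Proof.
by move=> /(_ _ (near_rnorm f _)) h r0; have [g [Sg fg]] := h _ r0; exists g.
Qed.

Lemma annihilator_closed (J : set V) :
  closed [set f : dual_space V | forall v, J v -> val f v = 0].
Proof.
move=> f fJ v Jv; apply: rnorm_eq0; apply/eqP; rewrite eq_le rnorm_ge0 andbT.
apply/ler_addgt0Pr => r r0; rewrite add0r.
have v0 : 0 < rnorm v + 1 by rewrite ltr_wpDl ?rnorm_ge0.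
have [g gJ fg] := closure_approx v fJ (divr_gt0 r0 v0).
rewrite -[val f v]subr0 -(gJ v Jv) (le_trans (dual_norm_bound (f - g) v))//.
move: fg; rewrite ltr_pdivlMr//.
by have := rnorm_ge0 v; have := rnorm_ge0 (f - g); nra.
Qed.

Definition annihilator (J : set V) : closed_subspace (dual_space V) :=
  closed_subspace_of_set (annihilator_submod_closed J) (@annihilator_closed J).

Lemma annihilatorP (J : set V) f :
  (f \in annihilator J) <-> forall v, J v -> val f v = 0.
Proof. exact: closed_subspace_of_setP. Qed.

End DualNorm.

(** * The dual of a quotient as an annihilator *)

Section QuotientDual.
Context {R : realType} {k : scalar_kind} {V E : normedModType (scalars R k)}.
Local Notation K := (scalars R k).
Variable Q : V -> E.
Hypothesis Q_linear : linear Q.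
Hypothesis Q_le : forall v, rnorm (Q v) <= rnorm v.
Hypothesis Q_lift : forall x, exists2 v, Q v = x & rnorm v <= rnorm x.

Let Z := annihilator [set v | Q v = 0].

Lemma pullback_linear (f : dual_space E) : linear (val f \o Q : V -> K^o).
Proof. by move=> a u v; rewrite /= Q_linear dual_linear. Qed.

Lemma pullback_bound (f : dual_space E) v :
  rnorm ((val f \o Q : V -> K^o) v) <= rnorm f * rnorm v.
Proof. by rewrite (le_trans (dual_norm_bound _ _))// ler_wpM2l ?rnorm_ge0. Qed.

Definition pullback (f : dual_space E) : dual_space V :=
  dual_of (pullback_linear f) (pullback_bound f).

Lemma pullback_annihilator f : pullback f \in Z.
Proof. by apply/annihilatorP => v /= ->; rewrite dual0. Qed.

(** [Q] maps the unit ball into the unit ball by [Q_le] and onto it by [Q_lift], so f and its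
    pullback have the same supremum. *)
Lemma rnorm_pullback f : rnorm (pullback f) = rnorm f.
Proof.
apply/eqP; rewrite eq_le; apply/andP; split; apply: dual_norm_le; rewrite ?rnorm_ge0//.
  by move=> v v1; exact: (dual_norm_ge f (le_trans (Q_le v) v1)).
move=> x x1; have [v vx vle] := Q_lift x.
by rewrite -vx -[val f _]/(val (pullback f) v) dual_norm_ge// (le_trans vle).
Qed.

(** As g vanishes on the kernel of [Q], its value at a lift of x is independent of the lift.
    Composing g with a choice of lifts, itself possibly nonlinear, therefore gives a linear
    functional, bounded because the lifts do not increase norms. *)
Lemma pullback_surj (g : dual_space V) : g \in Z -> exists f, pullback f = g.
Proof.
move=> /annihilatorP gZ.
have /choice[s sP] : forall x, exists v, Q v = x /\ rnorm v <= rnorm x.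
  by move=> x; have [v] := Q_lift x; exists v.
have QB u v : Q (u - v) = Q u - Q v by rewrite addrC -scaleN1r Q_linear scaleN1r addrC.
have gs u v : Q u = Q v -> val g u = val g v.
  by move=> uv; apply/eqP; rewrite -subr_eq0 -dualB gZ// /= QB uv subrr.
have fl : linear (val g \o s).
  move=> a x y; rewrite /= -[RHS]dual_linear; apply: gs.
  by rewrite Q_linear !(sP _).1.
have fb x : rnorm ((val g \o s) x) <= rnorm g * rnorm x.
  rewrite (le_trans (dual_norm_bound _ _))// ler_wpM2l ?rnorm_ge0//.
  exact: (sP x).2.
exists (dual_of fl fb); apply/val_inj/funext => v /=.
by apply: gs; rewrite (sP _).1.
Qed.

Lemma dual_quotient_isometry : isometrically_isomorphic (dual_space E) (subspace_of Z).
Proof.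
pose F f : subspace_of Z := Sub (pullback f) (pullback_annihilator f).
have Fl : linear F by move=> a f g; apply/val_inj/val_inj.
pose FL : {linear dual_space E -> subspace_of Z} :=
  HB.pack F (GRing.isLinear.Build K _ _ *:%R F Fl).
exists FL; split; last first.
  by move=> f; rewrite -!of_real_rnorm -rnorm_pullback.
have Finj : injective F.
  move=> f g /(congr1 val) /= fg; apply/eqP; rewrite -subr_eq0; apply/eqP/rnorm_eq0.
  rewrite -rnorm_pullback (_ : pullback (f - g) = pullback f - pullback g).
    by rewrite fg subrr rnorm_zero.
  exact/val_inj.
have /choice[G GK] : forall z : subspace_of Z, exists f, F f = z.
  by move=> [g gZ]; have [f fg] := pullback_surj gZ; exists f; exact/val_inj.
by exists G => // f; apply: Finj; rewrite GK.
Qed.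

End QuotientDual.

(** * L-summands *)

Section AnnihilatorLSummand.
Context {R : realType} {k : scalar_kind} {V : normedModType (scalars R k)}.
Local Notation K := (scalars R k).
Variables (J : set V) (cut : nat -> V -> V).
Hypothesis cut_linear : forall n, linear (cut n).
Hypothesis cutJ : forall n v, J (cut n v).
Hypothesis cut_cvg : forall v, J v -> cut n v @[n --> \oo] --> v.
Hypothesis cut_le : forall n v, rnorm (cut n v) <= rnorm v.
Hypothesis cut_mix : forall n x y, rnorm x <= 1 -> rnorm y <= 1 ->
  rnorm (x - cut n x + cut n y) <= 1.
Hypothesis cut_variation : forall n (s : nat -> R) v, (forall i, `|s i| <= 1) ->
  rnorm (\sum_(i < n) of_real (s i) *: (cut i.+1 v - cut i v)) <= rnorm v.

Lemma cvg_dual (f : dual_space V) (u : nat -> V) v :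
  u n @[n --> \oo] --> v -> val f (u n) @[n --> \oo] --> val f v.
Proof. by move=> uv; apply: continuous_cvg => //; exact: dual_continuous. Qed.

(* Testing [f] on the signed sums of [cut_variation] makes the increments of
   [rho (f (cut n v))] absolutely summable. *)
Lemma is_cvg_cut (rho : K -> R) (f : dual_space V) v :
  {morph rho : x y / x + y} -> (forall (a : R) x, rho (of_real a * x) = a * rho x) ->
  (forall x, `|rho x| <= rnorm (x : K^o)) ->
  cvg (rho (val f (cut n v)) @[n --> \oo]).
Proof.
move=> rhoD rhoZ rho_le; pose a n := rho (val f (cut n v)).
have rhoN x : rho (- x) = - rho x.
  by rewrite -mulN1r -(of_real1 (R := R)) -of_realN rhoZ mulN1r.
have rho0 : rho 0 = 0 by rewrite -(mul0r 0) -(of_real0 R k) rhoZ mul0r.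
have aE n : `|telescope a n| =
    rho (val f (of_real (Num.sg (telescope a n)) *: (cut n.+1 v - cut n v))).
  rewrite dualZ dualB rhoZ rhoD rhoN.
  exact: normrEsg.
have nb : cvgn (series (fun n => `|telescope a n|)).
  apply: nondecreasing_is_cvgn.
    by apply: nondecreasing_series => n _ _.
  exists (rnorm f * rnorm v) => _ [n _ <-].
  have -> : series (fun n => `|telescope a n|) n = rho (val f
      (\sum_(i < n) of_real (Num.sg (telescope a i)) *: (cut i.+1 v - cut i v))).
    rewrite /series /= big_mkord; elim: n => [|n IH].
      by rewrite !big_ord0 dual0 rho0.
    by rewrite !big_ord_recr dualD rhoD -IH -aE.
  rewrite (le_trans (ler_norm _))// (le_trans (rho_le _))//.
  rewrite (le_trans (dual_norm_bound _ _))// ler_wpM2l ?rnorm_ge0//.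
  apply: (@cut_variation n (fun i => Num.sg (telescope a i))) => i.
  by rewrite normr_sg; case: (_ != _).
have /normed_cvg ab := nb.
suff : cvgn a by [].
rewrite [a](_ : _ = fun n => a 0%N + series (telescope a) n).
  by apply: is_cvgD => //; exact: is_cvg_cst.
by apply/funext => n; exact: eq_sum_telescope.
Qed.

Let cut_limits := [set f : dual_space V |
  forall v, val f (cut n v) @[n --> \oo] --> val f v].

(** The part is g v = lim f (cut n v). It agrees with f on J, where [cut n v] tends to v; and as
    every [cut n v] lies in J, g (cut n v) = f (cut n v) tends to g v. *)
Lemma cut_part (f : dual_space V) : exists2 g, cut_limits g &
  forall v, J v -> val g v = val f v.
Proof.
have /choice[h hP] : forall v, exists y : K^o, val f (cut n v) @[n --> \oo] --> y.
  move=> v; have re := @is_cvg_cut real_part f v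
    (@real_partD R k) (@real_partZ R k) (@ler_real_part R k).
  have im := @is_cvg_cut imag_part f v
    (@imag_partD R k) (@imag_partZ R k) (@ler_imag_part R k).
  exists (of_parts (lim (real_part (val f (cut n v)) @[n --> \oo]))
                   (lim (imag_part (val f (cut n v)) @[n --> \oo]))).
  apply: (cvg_trans _ (cvg_of_parts re im)); apply: near_eq_cvg.
  by apply: nearW => n; rewrite of_partsK.
have hlim v y : val f (cut n v) @[n --> \oo] --> y -> h v = y.
  by move=> fy; exact: (cvg_unique (@norm_hausdorff _ K^o) (hP v) fy).
have hl : linear h.
  move=> a u v; apply: hlim.
  under eq_fun do rewrite cut_linear dual_linear.
  by apply: cvgD; [apply: cvgZr; exact: hP|exact: hP].
have hb v : rnorm (h v) <= rnorm f * rnorm v.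
  apply/ler_addgt0Pr => r r0; have /cvg_rnormP/(_ _ r0)[n _ /(_ n (leqnn n)) hn] := hP v.
  have := ler_rnormD (h v - val f (cut n v)) (val f (cut n v)); rewrite subrK.
  have := dual_norm_bound f (cut n v).
  have : rnorm f * rnorm (cut n v) <= rnorm f * rnorm v by rewrite ler_wpM2l ?rnorm_ge0.
  by move: hn; lra.
have hJ v : J v -> h v = val f v.
  by move=> Jv; apply: hlim; apply: cvg_dual; exact: cut_cvg.
exists (dual_of hl hb) => // v /=; have := hP v.
by under eq_fun do rewrite -hJ//.
Qed.

Lemma cut_limits_submod_closed : submod_closed (mem cut_limits).
Proof.
split=> [|a f g]; rewrite !inE; first by move=> v; exact: cvg_cst.
move=> fW gW v.
have E u : val (a *: f + g) u = a *: val f u + val g u by rewrite /= !fctE.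
rewrite E (_ : (fun n => val (a *: f + g) (cut n v)) =
  fun n => a *: val f (cut n v) + val g (cut n v)); last by apply/funext => n; exact: E.
by apply: cvgD; [apply: cvgZr; exact: fW|exact: gW].
Qed.

Lemma cut_limits_closed : closed cut_limits.
Proof.
move=> f fW v; apply/cvg_rnormP => r r0.
have r3 : 0 < r / 3 by rewrite divr_gt0.
have v0 : 0 < rnorm v + 1 by rewrite ltr_wpDl ?rnorm_ge0.
have [g gW fg] := closure_approx v fW (divr_gt0 r3 v0).
(* Each [cut n] is contractive, so this one bound serves at v and at every [cut n v]. *)
have small u : rnorm u <= rnorm v -> rnorm (val (f - g) u) <= r / 3.
  move=> uv; rewrite (le_trans (dual_norm_bound _ _))//.
  move: fg; rewrite ltr_pdivlMr// => fg.
  by have := rnorm_ge0 u; have := rnorm_ge0 (f - g); nra.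
have /cvg_rnormP/(_ _ r3) := gW v; apply: filterS => n gn.
have -> : val f v - val f (cut n v) =
    val (f - g) v + (val g v - val g (cut n v)) - val (f - g) (cut n v).
  rewrite -[val (f - g) v]/(val f v - val g v) addrA subrK.
  by rewrite -[val (f - g) _]/(val f (cut n v) - val g (cut n v)) opprB addrA subrK.
rewrite (le_lt_trans (ler_rnormD _ _))// rnormN.
have := ler_rnormD (val (f - g) v) (val g v - val g (cut n v)).
by have := small v (lexx _); have := small _ (cut_le n v); lra.
Qed.

Theorem annihilator_L_summand : L_summand (annihilator J).
Proof.
exists (closed_subspace_of_set cut_limits_submod_closed cut_limits_closed); split.
- move=> f; have [g gW gJ] := cut_part f; exists (f - g), g; split.
  + by apply/annihilatorP => v Jv; rewrite -[LHS]/(val f v - val g v) gJ// subrr.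
  + exact/closed_subspace_of_setP.
  + by rewrite subrK.
- move=> f /annihilatorP fJ /closed_subspace_of_setP fW; apply/val_inj/funext => v.
  have fcut0 : (fun n => val f (cut n v)) = cst 0 by apply/funext => n; exact: fJ.
  have := fW v; rewrite fcut0 => fv.
  exact: (cvg_unique (@norm_hausdorff _ K^o) fv (cvg_cst _)).
move=> z w /annihilatorP zJ /closed_subspace_of_setP wW.
apply/eqP; rewrite eq_le ler_normD/= -!of_real_rnorm -of_realD ler_of_real -lerBrDr.
(* Rotate x and y so that z x' and w y' are nonnegative reals. The test vector x' - cut n x' + cut n
   y' stays in the unit ball by [cut_mix]; z kills the cuts, while w (x' - cut n x') tends to 0 and
   w (cut n y') to w y'. *)
have zw_le x y : rnorm x <= 1 -> rnorm y <= 1 ->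
    rnorm (val z x) + rnorm (val w y) <= rnorm (z + w).
  have [a a1 ax] := rotation (val z x); have [b b1 bx] := rotation (val w y).
  move=> x1 y1; pose x' := a *: x; pose y' := b *: y.
  have x'1 : rnorm x' <= 1 by rewrite rnormZ mulr_ile1 ?rnorm_ge0.
  have y'1 : rnorm y' <= 1 by rewrite rnormZ mulr_ile1 ?rnorm_ge0.
  have -> : rnorm (val z x) + rnorm (val w y) = rnorm (val z x' + val w y' : K^o).
    rewrite !dualZ [a *: _]ax [b *: _]bx -of_realD rnorm_of_real ger0_norm//.
    by rewrite addr_ge0 ?rnorm_ge0.
  apply/ler_addgt0Pr => r r0; have r2 : 0 < r / 2 by rewrite divr_gt0.
  have /cvg_rnormP/(_ _ r2) hx := wW x'; have /cvg_rnormP/(_ _ r2) hy := wW y'.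
  have [n [hxn hyn]] := filter_ex (filterI hx hy).
  have zwE : val z x' + val w y' = val (z + w) (x' - cut n x' + cut n y')
      - (val w x' - val w (cut n x')) + (val w y' - val w (cut n y')).
    have zwv u : val (z + w) u = val z u + val w u by [].
    rewrite dualD dualB !zwv !(zJ _ (cutJ _ _)) !add0r.
    move: (val z x') (val w x') (val w y') (val w (cut n x')) (val w (cut n y')).
    by move=> c1 c2 c3 c4 c5; rewrite addrA opprB !addrA; ring.
  rewrite zwE (le_trans (ler_rnormD _ _))//.
  have := dual_norm_ge (z + w) (cut_mix n x'1 y'1).
  have := ler_rnormD (val (z + w) (x' - cut n x' + cut n y'))
    (- (val w x' - val w (cut n x'))).
  by rewrite rnormN; move: hxn hyn; lra.
(* The suprema over x and over y are taken in turn; setting one of the vectors to 0 in [zw_le] shows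
   that the intermediate bounds are nonnegative. *)
apply: dual_norm_le.
  rewrite subr_ge0; apply: dual_norm_le => [|y y1]; first exact: rnorm_ge0.
  by have := zw_le 0 y; rewrite dual0 !rnorm_zero add0r; apply.
move=> x x1; rewrite lerBrDr addrC -lerBrDr; apply: dual_norm_le.
  rewrite subr_ge0.
  by have := zw_le x 0; rewrite dual0 !rnorm_zero addr0; apply.
by move=> y y1; rewrite lerBrDr addrC zw_le.
Qed.

End AnnihilatorLSummand.

(** * Functions prescribed on a closed set *)

Section ContSpace.
Context {R : realType} {k : scalar_kind} {T : compactHausdorff}.
Local Notation K := (scalars R k).
Implicit Types f : cont_space R k T.

Lemma rnorm_cont f : rnorm f = rsup [set: T] (val f).
Proof. exact: of_realK. Qed.

Lemma cont_le f t : rnorm (val f t) <= rnorm f.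
Proof. by rewrite rnorm_cont rsup_ub//; exact: cont_rbounded. Qed.

Lemma cont_norm_le f M : 0 <= M -> (forall t, rnorm (val f t) <= M) -> rnorm f <= M.
Proof. by move=> M0 fM; rewrite rnorm_cont; apply: rsup_le. Qed.

Lemma cont_continuous f : continuous (val f).
Proof. exact: set_mem (valP f). Qed.

Definition cont_of (h : T -> K^o) (hc : continuous h) : cont_space R k T :=
  Sub h (mem_set hc : h \in @is_continuous R k T).

Lemma continuous_real_mul (h : T -> R) (f : T -> K^o) :
  continuous h -> continuous f -> continuous (fun t => of_real (h t) *: f t).
Proof.
move=> hc fc t; apply: cvgZ; last exact: fc.
by apply: cvg_of_real; exact: hc.
Qed.

Definition cont_mul (h : T -> R) (hc : continuous h) f : cont_space R k T :=
  cont_of (continuous_real_mul hc (@cont_continuous f)).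

End ContSpace.

(** * Continuous functions represented on a closed set by a vector *)

Section ExtensionSpace.
Context {R : realType} {k : scalar_kind} {T : compactHausdorff}.
Context {E : completeNormedModType (scalars R k)}.
Local Notation K := (scalars R k).
Local Notation C := (cont_space R k T).
Variables (D : set T) (phi : T -> E -> K^o).
Hypothesis phi_linear : forall t, D t -> linear (phi t).
Hypothesis phi_le : forall t x, D t -> rnorm (phi t x) <= rnorm x.
Hypothesis phi_norming : forall x, exists2 t, D t & rnorm (phi t x) = rnorm x.

Let restrict_set := [set f : C | exists x, forall t, D t -> val f t = phi t x].

Lemma phiB t x y : D t -> phi t (x - y) = phi t x - phi t y.
Proof.
by move=> Dt; rewrite addrC -scaleN1r (phi_linear Dt) scaleN1r addrC.
Qed.

Lemma phi0 t : D t -> phi t 0 = 0.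
Proof. by move=> Dt; rewrite -(subrr 0) phiB// subrr. Qed.

(** By the norming property, the vector representing f on [D] is unique and depends on f
    contractively. *)
Lemma phi_dist_le x y f g : (forall t, D t -> val f t = phi t x) ->
  (forall t, D t -> val g t = phi t y) -> rnorm (x - y) <= rnorm (f - g : C).
Proof.
move=> fx gy; have [t Dt <-] := phi_norming (x - y).
rewrite phiB// -fx// -gy//; exact: (cont_le (f - g) t).
Qed.

Lemma restrict_submod_closed : submod_closed (mem restrict_set).
Proof.
split=> [|a f g]; rewrite !inE; first by exists 0 => t Dt; rewrite phi0.
move=> [x fx] [y gy]; exists (a *: x + y) => t Dt.
by rewrite /= !fctE phi_linear// fx// gy.
Qed.

(** Functions of the set that tend to f are represented by vectors x_n, which form a Cauchy sequence
    by [phi_dist_le]. Completeness of [E] gives a limit, and it represents f. *)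
Lemma restrict_closed : closed restrict_set.
Proof.
move=> f fX.
have app (n : nat) : exists g : C * E, rnorm (f - g.1) < n.+1%:R^-1 /\
    forall t, D t -> val g.1 t = phi t g.2.
  have n0 : 0 < n.+1%:R^-1 :> R by rewrite invr_gt0.
  have [g [[x gx] fg]] := fX _ (near_rnorm f n0).
  by exists (g, x).
have [s sP] := choice app.
pose x n := (s n).2.
have xc n m : rnorm (x n - x m) <= n.+1%:R^-1 + m.+1%:R^-1.
  rewrite (le_trans (phi_dist_le (sP n).2 (sP m).2))//.
  rewrite -(subrK f (s n).1) -addrA (le_trans (ler_rnormD _ _))//.
  by rewrite lerD ?(ltW (sP m).1)// rnorm_distC ltW// (sP n).1.
have small (r : R) : 0 < r -> exists N, forall n, (N <= n)%N -> n.+1%:R^-1 < r.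
  move=> r0; have /cvgrPdist_lt/(_ _ r0)[N _ hN] := @cvg_harmonic R.
  by exists N => n /hN; rewrite sub0r normrN ger0_norm// invr_ge0.
have xcvg : cvg (x @ \oo).
  apply/cauchy_cvgP/cauchy_exP => r r0.
  have rE : of_real (real_part r) = r by rewrite real_partK// gtr0_real.
  have r'0 : 0 < real_part r by rewrite -(ltr_of_real k) of_real0 rE.
  have [N hN] := small _ (divr_gt0 r'0 (ltr0n _ 2)).
  exists (x N); exists N => // n /= Nn.
  rewrite -ball_normE /= -rE -of_real_rnorm ltr_of_real (le_lt_trans (xc _ _))//.
  by rewrite [ltRHS]splitr ltrD// hN.
exists (lim (x @ \oo)) => t Dt; apply/eqP; rewrite -subr_eq0; apply/eqP/rnorm_eq0/eqP.
rewrite eq_le rnorm_ge0 andbT; apply/ler_addgt0Pr => r r0; rewrite add0r.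
have r2 : 0 < r / 2 by rewrite divr_gt0.
have [N hN] := small _ r2.
have /cvg_rnormP/(_ _ r2) [M _ hM] := xcvg.
pose n := maxn N M.
have h1 := cont_le (f - (s n).1) t.
have h2 := phi_le (lim (x @ \oo) - x n) Dt.
have h3 : rnorm (lim (x @ \oo) - x n) < r / 2 := hM n (leq_maxr _ _).
have h4 := hN n (leq_maxl _ _).
have h5 := (sP n).1.
rewrite phiB// in h2.
have -> : val f t - phi t (lim (x @ \oo)) =
    val (f - (s n).1) t - (phi t (lim (x @ \oo)) - phi t (x n)).
  rewrite -[val (f - _) t]/(val f t - val (s n).1 t) (sP n).2//.
  by rewrite opprB addrA subrK.
rewrite (le_trans (ler_rnormD _ _))// rnormN [r]splitr lerD//.
  by rewrite (le_trans h1)// ltW// (lt_trans h5).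
by rewrite (le_trans h2)// ltW.
Qed.

Definition extension_space : closed_subspace C :=
  closed_subspace_of_set restrict_submod_closed restrict_closed.

Lemma extension_spaceP f :
  (f \in extension_space) <-> exists x, forall t, D t -> val f t = phi t x.
Proof. exact: closed_subspace_of_setP. Qed.

(** A bump vanishing on [D] is represented by the vector 0, so it lies in the space itself and its
    distance to the space is 0. *)
Lemma extension_space_C_rich :
  (forall U : set T, open U -> U !=set0 -> exists h : T -> R,
    [/\ continuous h, forall t, 0 <= h t <= 1, exists t, h t = 1,
        closure [set t | h t != 0] `<=` U & forall t, D t -> h t = 0]) ->
  C_rich extension_space.
Proof.
move=> bump U r oU U0 r0; have [h [hc h01 [t1 ht1] hU hD]] := bump U oU U0.
have hoc : continuous (fun t => of_real (h t) : K^o).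
  by move=> t; apply: cvg_of_real; exact: hc.
have hX : cont_of hoc \in extension_space.
  by apply/extension_spaceP; exists 0 => t Dt; rewrite /= hD// of_real0 phi0.
exists (cont_of hoc); split.
- by move=> t /=; rewrite -(of_real0 R k) ler_of_real; case/andP: (h01 t).
- rewrite -of_real_rnorm -(@of_real1 R k); congr of_real.
  apply/eqP; rewrite eq_le; apply/andP; split.
    apply: cont_norm_le => // t /=; rewrite rnorm_of_real.
    by case/andP: (h01 t) => h0 h1; rewrite ger0_norm.
  have := cont_le (cont_of hoc) t1.
  by rewrite /= rnorm_of_real ht1 normr1.
- move=> t; rewrite /closed_support => ht; apply: hU; apply: closure_subset ht => s /=.
  by apply: contraNN => /eqP ->; rewrite of_real0.
- apply: (@le_lt_trans _ _ 0) => //; apply: ge_inf.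
    by exists 0 => _ [f _ <-]; exact: rnorm_ge0.
  by exists (cont_of hoc) => //; rewrite subrr rnorm_zero.
Qed.

Local Notation X := (subspace_of extension_space).

Let ev (v : X) (t : T) : K^o := val (val v) t.

Lemma evD u v t : ev (u + v) t = ev u t + ev v t.
Proof. by rewrite /ev /= !fctE. Qed.

Lemma evB u v t : ev (u - v) t = ev u t - ev v t.
Proof. by rewrite /ev /= !fctE. Qed.

Lemma evZ a v t : ev (a *: v) t = a *: ev v t.
Proof. by rewrite /ev /= !fctE. Qed.

Lemma ev_inj u v : (forall t, ev u t = ev v t) -> u = v.
Proof. by move=> uv; apply/val_inj/val_inj/funext. Qed.

Lemma ev_le v t : rnorm (ev v t) <= rnorm v.
Proof. exact: cont_le. Qed.

Lemma ev_norm_le v M : 0 <= M -> (forall t, rnorm (ev v t) <= M) -> rnorm v <= M.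
Proof. exact: cont_norm_le. Qed.

Lemma mul_in_extension_space (h : T -> R) (hc : continuous h) (v : X) :
  (forall t, D t -> h t = 0) -> cont_mul hc (val v) \in extension_space.
Proof.
move=> hD; apply/extension_spaceP; exists 0 => t Dt.
by rewrite /= hD// of_real0 scale0r phi0.
Qed.

(** Increasing multipliers that vanish on [D]; [g_approx] says that g_n f tends to f uniformly when
    f vanishes on [D]. Multiplication by them provides the cuts of the L-summand theorem. *)
Variable g : nat -> T -> R.
Hypothesis g_cont : forall n, continuous (g n).
Hypothesis g_01 : forall n t, 0 <= g n t <= 1.
Hypothesis g_incr : forall n t, g n t <= g n.+1 t.
Hypothesis g_D : forall n t, D t -> g n t = 0.
Hypothesis g_approx : forall f : C, (forall t, D t -> val f t = 0) ->
  forall r : R, 0 < r -> \forall n \near \oo,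
    forall t, (1 - g n t) * rnorm (val f t) <= r.

Let cut n (v : X) : X :=
  Sub (cont_mul (@g_cont n) (val v)) (mul_in_extension_space (@g_cont n) v (@g_D n)).

Lemma ev_cut n v t : ev (cut n v) t = of_real (g n t) *: ev v t.
Proof. by []. Qed.

Hypothesis phi_ext : forall x, exists2 f : C,
  rnorm f <= rnorm x & forall t, D t -> val f t = phi t x.

Theorem extension_space_dual : exists Z : closed_subspace (dual_space X),
  L_summand Z /\ isometrically_isomorphic (dual_space E) (subspace_of Z).
Proof.
(* [Q v] is the vector representing v on [D], so the kernel of [Q] consists of the functions of the
   space that vanish on [D]. *)
have /choice[Q QP] : forall v : X, exists x, forall t, D t -> ev v t = phi t x.
  by move=> v; have /extension_spaceP := valP v.
have phi_inj x y : (forall t, D t -> phi t x = phi t y) -> x = y.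
  move=> xy; apply/eqP; rewrite -subr_eq0; apply/eqP/rnorm_eq0.
  by have [t Dt <-] := phi_norming (x - y); rewrite phiB// xy// subrr rnorm_zero.
have Q_linear : linear Q.
  move=> a u v; apply: phi_inj => t Dt.
  by rewrite -QP// evD evZ phi_linear// !QP.
have Q_le v : rnorm (Q v) <= rnorm v.
  by have [t Dt <-] := phi_norming (Q v); rewrite -QP// ev_le.
have Q_lift x : exists2 v, Q v = x & rnorm v <= rnorm x.
  have [f fx fD] := phi_ext x.
  have fX : f \in extension_space by apply/extension_spaceP; exists x.
  exists (Sub f fX) => //; apply: phi_inj => t Dt.
  by rewrite -QP//; exact: fD.
exists (annihilator [set v | Q v = 0]); split; last exact: dual_quotient_isometry.
have mul_le (c : R) (z : K^o) : 0 <= c -> rnorm (of_real c *: z) = c * rnorm z.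
  by move=> c0; rewrite rnormZr ger0_norm.
apply: (@annihilator_L_summand _ _ _ _ cut).
- move=> n a u v; apply: ev_inj => t.
  by rewrite evD evZ !ev_cut evD evZ scalerDr !scalerA mulrC.
- move=> n v /=; apply: phi_inj => t Dt.
  by rewrite -QP// ev_cut g_D// of_real0 scale0r phi0.
- move=> v /= Qv; apply/cvg_rnormP => r r0.
  have vD t : D t -> val (val v) t = 0 by move=> Dt; rewrite -[LHS]/(ev v t) QP// Qv phi0.
  have := g_approx vD (divr_gt0 r0 (ltr0n _ 2)); apply: filterS => n gn.
  rewrite (@le_lt_trans _ _ (r / 2))//; last by rewrite ltr_pdivrMr// ltr_pMr// ltr1n.
  apply: ev_norm_le => [|t]; first by rewrite divr_ge0// ltW.
  rewrite evB ev_cut (_ : _ - _ = of_real (1 - g n t) *: ev v t); last first.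
    by rewrite of_realD of_realN of_real1 scalerBl scale1r.
  by rewrite mul_le ?gn// subr_ge0; case/andP: (g_01 n t).
- move=> n v; apply: ev_norm_le => [|t]; first exact: rnorm_ge0.
  have /andP[g0 g1] := g_01 n t; rewrite ev_cut mul_le//.
  by rewrite (le_trans _ (ev_le v t))// ler_piMl// rnorm_ge0.
(* At each point t the mixed function is a convex combination of x t and y t, with weights 1 - g_n t
   and g_n t. *)
- move=> n x y x1 y1; apply: ev_norm_le => // t.
  have /andP[g0 g1] := g_01 n t; rewrite evD evB !ev_cut.
  rewrite (_ : ev x t - _ = of_real (1 - g n t) *: ev x t); last first.
    by rewrite of_realD of_realN of_real1 scalerBl scale1r.
  rewrite (le_trans (ler_rnormD _ _))// !mul_le ?subr_ge0//.
  have := le_trans (ev_le x t) x1; have := le_trans (ev_le y t) y1.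
  by have := rnorm_ge0 (ev x t); have := rnorm_ge0 (ev y t); nra.
(* The increments of g_n t are nonnegative and telescope to at most 1, so signs bounded by 1 cannot
   push the sum beyond |v t|. *)
- move=> n s v s1; apply: ev_norm_le => [|t]; first exact: rnorm_ge0.
  apply: (@le_trans _ _ ((g n t - g 0 t) * rnorm (ev v t))); last first.
    have := g_01 n t; have := g_01 0 t; have := ev_le v t.
    by have := rnorm_ge0 (ev v t); nra.
  elim: n => [|n IH].
    by rewrite big_ord0 subrr mul0r /ev /= rnorm_zero.
  rewrite big_ord_recr evD (le_trans (ler_rnormD _ _))//.
  have -> : (g n.+1 t - g 0 t) * rnorm (ev v t) =
      (g n t - g 0 t) * rnorm (ev v t) + (g n.+1 t - g n t) * rnorm (ev v t) by ring.
  rewrite lerD// evZ evB !ev_cut -scalerBl -of_realN -of_realD rnormZr.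
  rewrite mul_le ?subr_ge0// ler_piMl// mulr_ge0 ?rnorm_ge0// subr_ge0.
  exact: g_incr.
Qed.

End ExtensionSpace.

(** * Cutoffs, bumps and extensions on the interval *)

Section DistanceToSet.
Context {R : realType} (S : set R) (S0 : S !=set0).

Definition set_dist (t : R) : R := inf [set `|t - s| | s in S].

Let dist_lb t : has_lbound [set `|t - s| | s in S].
Proof. by exists 0 => _ [s _ <-]. Qed.

Lemma set_dist_le t s : S s -> set_dist t <= `|t - s|.
Proof. by move=> Ss; apply: ge_inf => //; exists s. Qed.

Lemma le_set_dist t r : (forall s, S s -> r <= `|t - s|) -> r <= set_dist t.
Proof.
move=> rS; apply: lb_le_inf; first by have [s Ss] := S0; exists `|t - s|, s.
by move=> _ [s Ss <-]; exact: rS.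
Qed.

Lemma set_dist_ge0 t : 0 <= set_dist t.
Proof. by apply: le_set_dist. Qed.

Lemma set_dist0 t : S t -> set_dist t = 0.
Proof.
move=> St; apply/eqP; rewrite eq_le set_dist_ge0 andbT.
by rewrite (le_trans (set_dist_le _ St))// subrr normr0.
Qed.

Lemma set_dist_lipschitz t s : `|set_dist t - set_dist s| <= `|t - s|.
Proof.
have le t' s' : set_dist t' - `|t' - s'| <= set_dist s'.
  apply: le_set_dist => q Sq; have := set_dist_le t' Sq.
  by have := ler_distD s' t' q; lra.
rewrite ler_norml; apply/andP; split; last by have := le t s; lra.
by have := le s t; rewrite distrC; lra.
Qed.

Lemma continuous_set_dist : continuous set_dist.
Proof.
move=> t; apply/cvgrPdist_lt => r r0.
have /cvgrPdist_lt/(_ _ r0) := @cvg_id _ (nbhs t).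
by apply: filterS => s; apply: le_lt_trans; exact: set_dist_lipschitz.
Qed.

Lemma set_dist_gt0 t : closed S -> ~ S t -> 0 < set_dist t.
Proof.
move=> cS nSt; have : nbhs t (~` S).
  by apply: open_nbhs_nbhs; split => //; exact: closed_openC.
move=> /nbhs_ballP[r /= r0 rS]; apply: lt_le_trans r0 (le_set_dist _) => s Ss.
rewrite leNgt; apply/negP => ts; exact: (rS s).
Qed.

End DistanceToSet.

Section PulledBackSet.
Context {R : realType} {k : scalar_kind} {T : compactHausdorff}.
Local Notation K := (scalars R k).

Lemma continuous_rnorm (f : T -> K^o) :
  continuous f -> continuous (fun t => rnorm (f t)).
Proof.
move=> fc t; apply/cvgrPdist_lt => r r0.
have /cvg_rnormP/(_ _ r0) := fc t; apply: filterS => s.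
by apply: le_lt_trans; exact: ler_dist_rnorm.
Qed.

Variables (v : T -> R) (v_cont : continuous v).
Variables (S : set R) (S_closed : closed S) (S0 : S !=set0).
Let D : set T := v @^-1` S.

Lemma preimage_set_closed : closed D.
Proof. by apply: preimage_closed => // t _; exact: v_cont. Qed.

Definition cutoff (n : nat) (t : T) : R := Num.min 1 (n%:R * set_dist S (v t)).

Lemma continuous_set_dist_val : continuous (fun t : T => set_dist S (v t)).
Proof.
move=> t; have vc := @v_cont t.
exact: (continuous_comp vc (@continuous_set_dist R S S0 (v t))).
Qed.

Lemma continuous_cutoff n : continuous (cutoff n).
Proof.
suff : continuous (cst 1 \min (fun t => n%:R * set_dist S (v t)) : T -> R) by [].
apply: min_fun_continuous; first exact: cst_continuous.
move=> t.
by apply: cvgMl_tmp; exact: continuous_set_dist_val.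
Qed.

Lemma cutoff01 n t : 0 <= cutoff n t <= 1.
Proof.
by rewrite /cutoff ge_min lexx /= le_min ler01 mulr_ge0// set_dist_ge0.
Qed.

Lemma cutoff_incr n t : cutoff n t <= cutoff n.+1 t.
Proof.
rewrite /cutoff le_min ge_min lexx /= ge_min ler_wpM2r ?orbT//.
  exact: set_dist_ge0.
by rewrite ler_nat.
Qed.

Lemma cutoff_eq0 n t : D t -> cutoff n t = 0.
Proof. by move=> Dt; rewrite /cutoff set_dist0// mulr0 min_r. Qed.

(** Where |f| < r the bound is immediate. The set where |f| >= r is compact and misses [D], so the
    distance to S has a positive minimum on it, and for n beyond the inverse of that minimum the
    cutoff is 1 there. *)
Lemma cutoff_approx (f : cont_space R k T) : (forall t, D t -> val f t = 0) ->
  forall r : R, 0 < r ->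
  \forall n \near \oo, forall t, (1 - cutoff n t) * rnorm (val f t) <= r.
Proof.
move=> fD r r0; pose A : set T := [set t | r <= rnorm (val f t)].
have out n t : ~ A t -> (1 - cutoff n t) * rnorm (val f t) <= r.
  move=> /negP; rewrite -ltNge => /ltW; apply: le_trans.
  by rewrite ler_piMl ?rnorm_ge0//; have := cutoff01 n t; lra.
have [A0|A0] := pselect (A !=set0); last first.
  by apply: nearW => n t; apply: out => At; apply: A0; exists t.
have cA : compact A.
  apply: (subclosed_compact _ (@ch_compact T)) => //.
  rewrite (_ : A = (fun t => rnorm (val f t)) @^-1` [set s | r <= s])//.
  apply: preimage_closed; last exact: closed_ge.
  by move=> t _; apply: continuous_rnorm; exact: cont_continuous.
have dc : {within A, continuous (fun t => set_dist S (v t))}.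
  by apply: continuous_subspaceT; exact: continuous_set_dist_val.
have [c cA' cmin] := compact_EVT_min A0 cA dc.
have d0 : 0 < set_dist S (v c).
  apply: set_dist_gt0 => // Sc; move/set_mem : cA'.
  by rewrite /A /= fD// rnorm_zero leNgt r0.
exists (Num.trunc (set_dist S (v c))^-1).+1 => // n /= nN t.
have [At|] := pselect (A t); last exact: out.
rewrite /cutoff min_l ?subrr ?mul0r ?(ltW r0)//.
have h := cmin _ (mem_set At).
rewrite (@le_trans _ _ (n%:R * set_dist S (v c)))//; last by rewrite ler_wpM2l.
rewrite -ler_pdivrMr// mul1r ltW//.
by rewrite (lt_le_trans (truncnS_gt _))// ler_nat.
Qed.

Lemma bump_function (p r : R) (U : set T) : (exists t, v t = p) -> 0 < r ->
  (forall t, `|v t - p| < r -> U t /\ ~ D t) ->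
  exists h : T -> R, [/\ continuous h, forall t, 0 <= h t <= 1, exists t, h t = 1,
    closure [set t | h t != 0] `<=` U & forall t, D t -> h t = 0].
Proof.
move=> [q qp] r0 UD.
(* The slope 2 / r makes h vanish from distance r / 2 on, so the closed support stays inside the
   open r-neighbourhood of p. *)
pose h t := Num.max 0 (1 - `|v t - p| * (2 / r)).
have r2 : 0 < 2 / r by rewrite divr_gt0.
have h0 t : r / 2 <= `|v t - p| -> h t = 0.
  move=> tr; rewrite /h max_l// subr_le0 -ler_pdivrMr//.
  by rewrite mul1r invf_div.
have distc : continuous (fun t => `|v t - p|).
  move=> t; apply: cvg_norm; apply: cvgB; last exact: cvg_cst.
  exact: v_cont.
exists h; split.
- suff : continuous (cst 0 \max (fun t => 1 - `|v t - p| * (2 / r)) : T -> R) by [].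
  apply: max_fun_continuous; first exact: cst_continuous.
  move=> t.
  by apply: cvgB; [exact: cvg_cst|apply: cvgMr_tmp; exact: distc].
- move=> t; rewrite /h le_max lexx ge_max ler01 /= gerBl mulr_ge0// ltW//.
- by exists q; rewrite /h qp subrr normr0 mul0r subr0 max_r.
- have cB : closed [set t | `|v t - p| <= r / 2].
    rewrite (_ : [set t | _] = (fun t => `|v t - p|) @^-1` [set s | s <= r / 2])//.
    by apply: preimage_closed; [move=> t _; exact: distc|exact: closed_le].
  move=> t ht; have /cB /= tr : closure [set t | `|v t - p| <= r / 2] t.
    apply: closure_subset ht => s /= hs; rewrite leNgt; apply/negP => sr.
    by move: hs; rewrite h0 ?eqxx// ltW.
  by apply: (UD t _).1; rewrite (le_lt_trans tr)//; lra.
- move=> t Dt; apply: h0; rewrite leNgt; apply/negP => tr.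
  by have [|_] := UD t; [lra|apply].
Qed.

Lemma real_extension (F : T -> R) (M : R) :
  (forall t (r : R), D t -> 0 < r -> \forall s \near t, D s -> `|F t - F s| < r) ->
  (forall t, D t -> `|F t| <= M) ->
  exists2 G : T -> R, continuous G & forall t, D t -> G t = F t.
Proof.
move=> Fc FM.
have nT : normal_space T.
  by apply: compact_normal; [exact: ch_hausdorff|exact: ch_compact].
(* Tietze's theorem is applied with a positive bound, whence |M| + 1 in place of M. *)
have M0 : 0 < `|M| + 1 by rewrite ltr_wpDl.
have Fw : {within D, continuous F}.
  apply/subspace_continuousP => t Dt; apply/cvgrPdist_lt => r r0.
  by have := Fc t r Dt r0.
have FM' t : D t -> `|F t| <= `|M| + 1.
  by move=> /FM h; have := ler_norm M; lra.
have [G [GF Gc _]] := continuous_bounded_extension nT preimage_set_closed M0 Fw FM'.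
by exists G => // t Dt; rewrite GF// inE.
Qed.

(* The extension of [F] is composed with the radial retraction of the scalars
   onto the closed disc of radius [M]. *)
Lemma scalar_extension (F : T -> K^o) (M : R) :
  (forall t (r : R), D t -> 0 < r -> \forall s \near t, D s ->
    `|real_part (F t) - real_part (F s)| < r) ->
  (forall t (r : R), D t -> 0 < r -> \forall s \near t, D s ->
    `|imag_part (F t) - imag_part (F s)| < r) ->
  0 <= M -> (forall t, D t -> rnorm (F t) <= M) ->
  exists2 f : cont_space R k T, rnorm f <= M & forall t, D t -> val f t = F t.
Proof.
(* If M = 0 then F vanishes on [D] and the zero function serves; otherwise M > 0 keeps the
   denominator of the retraction positive. *)
move=> Frc Fic; rewrite le_eqVlt => /predU1P[<- F0|M0 FM].
  exists 0 => [|t Dt]; first by rewrite rnorm_zero.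
  by apply/esym/rnorm_eq0/eqP; rewrite eq_le rnorm_ge0 F0.
have [G1 G1c G1F] : exists2 G : T -> R, continuous G &
    forall t, D t -> G t = real_part (F t).
  by apply: (real_extension Frc) => t Dt; exact: le_trans (ler_real_part _) (FM _ Dt).
have [G2 G2c G2F] : exists2 G : T -> R, continuous G &
    forall t, D t -> G t = imag_part (F t).
  by apply: (real_extension Fic) => t Dt; exact: le_trans (ler_imag_part _) (FM _ Dt).
pose G t : K^o := of_parts (G1 t) (G2 t).
have Gc : continuous G by move=> t; apply: cvg_of_parts; [exact: G1c|exact: G2c].
pose N t := Num.max M (rnorm (G t)).
have N0 t : 0 < N t by rewrite lt_max M0.
have Nc : continuous N.
  suff : continuous (cst M \max (fun t => rnorm (G t)) : T -> R) by [].
  apply: max_fun_continuous; first exact: cst_continuous.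
  exact: continuous_rnorm.
have hc : continuous (fun t => M / N t).
  move=> t; apply: cvgMl_tmp; apply: cvgV; last exact: Nc.
  by rewrite gt_eqF.
exists (cont_of (continuous_real_mul hc Gc)).
  apply: cont_norm_le => [|t /=]; first exact: ltW.
  rewrite rnormZr ger0_norm; last by rewrite divr_ge0 ?ltW.
  rewrite mulrAC ler_pdivrMr// ler_wpM2l ?(ltW M0)//.
  by rewrite /N le_max lexx orbT.
move=> t Dt /=; have GF : G t = F t by rewrite /G G1F// G2F// of_partsK.
rewrite /N GF max_l ?FM// divff ?gt_eqF//.
by rewrite of_real1 scale1r.
Qed.

End PulledBackSet.

Section UnitInterval.
Context {R : realType}.
Local Notation I := (unit_interval R).

Definition itv_val (t : I) : R := val (t : unit_itv_type R).

Lemma continuous_itv_val : continuous itv_val.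
Proof. exact: initial_continuous. Qed.

Lemma itv_val01 t : 0 <= itv_val t <= 1.
Proof. by have := set_mem (valP (t : unit_itv_type R)); rewrite /= in_itv. Qed.

Lemma itv_val_ex r : 0 <= r <= 1 -> exists t, itv_val t = r.
Proof.
move=> r01; have rI : r \in [set` `[(0 : R), 1]] by rewrite inE /= in_itv.
by exists (exist _ r rI : unit_itv_type R).
Qed.

Variables (S : set R) (S_closed : closed S) (S0 : S !=set0).
Let D : set I := itv_val @^-1` S.

Lemma bump_functions :
  (forall a b : R, 0 <= a -> a < b -> b <= 1 -> exists t, [/\ a < t, t < b & ~ S t]) ->
  forall U : set I, open U -> U !=set0 ->
  exists h : I -> R, [/\ continuous h, forall t, 0 <= h t <= 1, exists t, h t = 1,
    closure [set t | h t != 0] `<=` U & forall t, D t -> h t = 0].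
Proof.
move=> nd U oU [x Ux].
have Ux' : nbhs (x : unit_itv_type R) U by exact: open_nbhs_nbhs.
have [B Bx BU] := unit_itv_nbhs Ux'; have /nbhs_ballP[d /= d0 dB] := Bx.
have xdU t : `|itv_val x - itv_val t| < d -> U t by move=> h; apply/BU/dB.
(* The interval has y as an endpoint and runs to the right if y <= 1/2, to the left otherwise; its
   length min d (1/2) keeps it within [0, 1] and within d of y. *)
have [a [b [a0 ab b1 abd]]] : exists a b, [/\ 0 <= a, a < b, b <= 1 &
    forall s, a < s < b -> `|itv_val x - s| < d].
  have := itv_val01 x; set y := itv_val x => y01.
  have m0 : 0 < Num.min d (1 / 2) by rewrite lt_min d0 divr_gt0.
  have [yh|yh] := leP y (1 / 2).
    exists y, (y + Num.min d (1 / 2)); split; rewrite ?ltrDl//; first by case/andP: y01.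
    + have : Num.min d (1 / 2) <= 1 / 2 by rewrite ge_min lexx orbT.
      by lra.
    + have : Num.min d (1 / 2) <= d by rewrite ge_min lexx.
      by move=> ? s ?; rewrite ltr_distl; lra.
  exists (y - Num.min d (1 / 2)), y; split; rewrite ?gtrBl//.
  + have : Num.min d (1 / 2) <= 1 / 2 by rewrite ge_min lexx orbT.
    by lra.
  + by case/andP: y01.
  + have : Num.min d (1 / 2) <= d by rewrite ge_min lexx.
    by move=> ? s ?; rewrite ltr_distl; lra.
have [p [ap pb nSp]] := nd a b a0 ab b1.
have dp := set_dist_gt0 S0 S_closed nSp.
(* This radius keeps the ball about p inside (a, b) and away from S. *)
pose r := Num.min (set_dist S p) (Num.min (p - a) (b - p)).
have r0 : 0 < r by rewrite !lt_min dp !subr_gt0 ap.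
apply: (@bump_function _ _ _ continuous_itv_val S p r) => //.
  by apply: itv_val_ex; lra.
move=> t; rewrite !lt_min => /and3P[h1 h2 h3]; split.
  by apply/xdU/abd; move: h2 h3; rewrite !ltr_norml; lra.
move=> Dt; have := set_dist_le p Dt; rewrite distrC leNgt => /negP; exact.
Qed.

End UnitInterval.

(** * Assembly of the space X(E) *)

Lemma dense_sequence (R : realType) (k : scalar_kind)
    (E : normedModType (scalars R k)) : separable_space E ->
  exists e : nat -> E, forall (x : E) (r : R), 0 < r -> exists n, rnorm (x - e n) < r.
Proof.
move=> [A Ac Ad].
have A_near (x : E) (r : R) : 0 < r -> exists2 y, A y & rnorm (x - y) < r.
  move=> r0; have [||y [ry Ay]] := Ad (interior [set w | rnorm (x - w) < r]).
  - by exists x; exact: near_rnorm.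
  - exact: open_interior.
  - by exists y => //; exact: (interior_subset ry).
have /pfcard_geP[A0|[e]] := Ac.
  by have [y] := A_near 0 1 ltr01; rewrite A0.
exists e => x r r0; have [y Ay xy] := A_near x r r0.
by have [n _ ny] := @surj _ _ _ _ e _ Ay; exists n; rewrite ny.
Qed.

(** The scalar j is 0 or - i. Imaginary parts of phi_t x become real parts of phi_t (j x), whose
    continuity in t on the coding set is known. *)
Lemma imag_part_real_part (R : realType) (k : scalar_kind) :
  exists j : scalars R k, forall z, imag_part z = real_part (j * z).
Proof.
rewrite /imag_part /real_part /scalars; case: k; first by exists 0 => z; rewrite mul0r.
by exists (- 'i) => -[a b] /=; rewrite oppr0 mul0r mulN1r sub0r opprK.
Qed.

Unset Implicit Arguments.

Theorem theorem3p3 (R : realType) (k : scalar_kind)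
    (E : completeNormedModType (scalars R k)) :
  separable_space E ->
  exists X : closed_subspace (cont_space R k (unit_interval R)),
    C_rich X /\
    exists Z : closed_subspace (dual_space (subspace_of X)),
      L_summand Z /\
      isometrically_isomorphic (dual_space E) (subspace_of Z).
Proof.
move=> /dense_sequence[e e_dense].
have [u [u_lin u_norming u_cont]] := functional_coding e_dense.
pose S := code_set e; pose v := @itv_val R; pose D := v @^-1` S.
have S01 s : S s -> 0 <= s <= 1 by move=> [[]]; rewrite /= in_itv.
have S0 : S !=set0 by have [s Ss _] := u_norming 0; exists s.
have S_closed : closed S by exact: closed_code_set.
have v_cont : continuous v by exact: continuous_itv_val.
(* On [D] this is the functional whose real part is coded by the number [v t]; off [D] it is zero by
   default. *)
have /choice[phi phiP] : forall t, exists f : E -> (scalars R k)^o,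
    D t -> [/\ linear f, forall x, rnorm (f x) <= rnorm x &
               forall x, real_part (f x) = u (v t) x].
  move=> t; have [Dt|nDt] := pselect (D t); last by exists (fun=> 0).
  by have [ul un] := u_lin _ Dt; have [f fP] := complexification ul un; exists f.
have phi_linear t : D t -> linear (phi t) by move=> /phiP[].
have phi_le t x : D t -> rnorm (phi t x) <= rnorm x by move=> /phiP[].
have phi_re t x : D t -> real_part (phi t x) = u (v t) x by move=> /phiP[].
have [j jP] := imag_part_real_part R k.
have phi_im t x : D t -> imag_part (phi t x) = u (v t) (j *: x).
  move=> Dt; rewrite jP -phi_re//; congr real_part.
  have p0 : phi t 0 = 0 by exact: phi0 phi_linear _ Dt.
  by have := phi_linear _ Dt j x 0; rewrite p0 !addr0 => ->.
have phi_norming x : exists2 t, D t & rnorm (phi t x) = rnorm x.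
  have [s Ss sx] := u_norming x; have [t tE] := itv_val_ex (S01 _ Ss).
  have Dt : D t by rewrite /D /= /v tE.
  (* The real part of phi_t x already equals |x|, and its modulus is at most |x|. *)
  exists t => //; apply/eqP; rewrite eq_le phi_le//= -sx -tE -phi_re//.
  exact: le_trans (ler_norm _) (ler_real_part _).
have u_cont_val x t (r : R) : D t -> 0 < r ->
    \forall s \near t, D s -> `|u (v t) x - u (v s) x| < r.
  by move=> Dt r0; have := v_cont t _ (u_cont x _ _ Dt r0).
have phi_ext x : exists2 f : cont_space R k (unit_interval R),
    rnorm f <= rnorm x & forall t, D t -> val f t = phi t x.
  apply: (@scalar_extension R k (unit_interval R) v v_cont S S_closed (phi^~ x)
    (rnorm x)).
  - move=> t r Dt r0; have := u_cont_val x t r Dt r0.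
    by apply: filterS => s h Ds; rewrite !phi_re// h.
  - move=> t r Dt r0; have := u_cont_val (j *: x) t r Dt r0.
    by apply: filterS => s h Ds; rewrite !phi_im// h.
  - exact: rnorm_ge0.
  - by move=> t Dt; exact: phi_le.
exists (extension_space phi_linear phi_le phi_norming); split.
  (* Every open subinterval of [0, 1] contains a zero of some wave; there |wave| < [cos_gap], so the
     point lies off the Cantor set and hence off S. *)
  apply: extension_space_C_rich; apply: bump_functions => // a b a0 ab b1.
  have [n [t [ta tb tn]]] := wave_zero a0 ab.
  exists t; split => // -[[_ /(_ n)]].
  by rewrite tn normr0 leNgt cos_gap_gt0.
apply: (@extension_space_dual R k (unit_interval R) E D phi
  phi_linear phi_le phi_norming (cutoff v S)) => //.
- by move=> n; exact: continuous_cutoff.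
- by move=> n t; exact: cutoff01.
- by move=> n t; exact: cutoff_incr.
- by move=> n t Dt; exact: cutoff_eq0.
- by move=> f fD r r0; exact: cutoff_approx.
Qed.
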